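(* Let $k$ be a $p$-adic field of odd residual characteristic, $G=\mathrm{SL}_2(k)$ and $K=\mathrm{SL}_2(\mathcal{R})$. Let $\pi$ be an irreducible (smooth, complex) representation of $G$ of depth $r\ge 0$, and let $\vartheta$ denote the central character of $\pi$. Then every irreducible component of the restriction $\mathrm{Res}_K\pi$ whose depth is greater than $2r$ is isomorphic to a member of the set $$\{\,\mathcal{S}_d(\vartheta,X_{1,0}),\ \mathcal{S}_d(\vartheta,X_{\varepsilon,0}) \mid d\in\mathbb{Z},\ d>2r\,\}.$$
   Context: Notation. $k$ is a $p$-adic field with integer ring $\mathcal{R}$, maximal ideal $\mathcal{P}$, uniformizer $\varpi$, residue field of odd characteristic and cardinality $q$, and valuation $\mathrm{val}$ with $\mathrm{val}(\varpi)=1$. $\varepsilon\in\mathcal{R}^\times$ is a fixed nonsquare, chosen to be $-1$ if $-1$ is not a square. $\Psi$ is a fixed additive character of $k$ that is trivial on $\mathcal{P}$ and nontrivial on $\mathcal{R}$. The center of $G$ is $Z=\{\pm I\}$. For real $r$, $\lceil r\rceil$ is the least integer $\ge r$ and $\lceil r+\rceil$ is the least integer $>r$. Filtrations and depth. For $x\in\mathbb{R}$ (a point of the standard apartment of the Bruhat-Tits building of $G$) and $r>0$, $G_{x,r}$ is the group of matrices in $G$ of the form $\begin{pmatrix}1+\mathcal{P}^{\lceil r\rceil}&\mathcal{P}^{\lceil r-x\rceil}\\ \mathcal{P}^{\lceil r+x\rceil}&1+\mathcal{P}^{\lceil r\rceil}\end{pmatrix}$; for $r\ge0$, $G_{x,r+}$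 is defined by the same formula with $\lceil r+\rceil,\lceil (r-x)+\rceil,\lceil (r+x)+\rceil$ in place of $\lceil r\rceil,\lceil r-x\rceil,\lceil r+x\rceil$. Every point of the building is $G$-conjugate to a point of this apartment. The depth of an irreducible smooth representation of $G$ is the least $r\ge0$ such that, for some $x$, it has a nonzero $G_{x,r+}$-fixed vector. The depth of an irreducible smooth representation of $K$ is its depth relative to the point $0$: the least $r\ge0$ such that it has a nonzero $G_{0,r+}$-fixed vector. Shalika's ramified representations of $K$. For $u,v\in k$ put $X_{u,v}=\begin{pmatrix}0&u\\ v&0\end{pmatrix}$. Let $\ell>0$, $\ell\in\frac12\mathbb{Z}$, and let $G_{[0,\frac12],\ell}=\bigcap_{x\in[0,\frac12]}G_{x,\ell}$, i.e. the matrices in $G$ of the form $\begin{pmatrix}1+\mathcal{P}^{\lceil \ell\rceil}&\mathcal{P}^{\lceil \ell\rceil}\\ \mathcal{P}^{\lceil \ell+\frac12\rceil}&1+\mathcal{P}^{\lceil \ell\rceil}\end{pmatrix}$. For $X=X_{u,v}$ with $\mathrm{val}(v)>\mathrm{val}(u)=0$ (with $v=0$ allowed), $\Psi_X(z)=\Psi(\varpi^{-2\ell}\mathrm{Tr}(X(z-I)))$ is a character of $G_{[0,\frac12],\ell}$. Let $C(X)$ be the centralizer of $X$ in $K$. If $\varphi$ is a character of $C(X)$ agreeing with $\Psi_X$ on $C(X)\cap G_{[0,\frac12],\ell}$, then $\varphi\Psi_X$ is a character of $C(X)G_{[0,\frac12],\ell}$ and $$\mathcal{S}_{2\ell}(\varphi,X):=\mathrm{Ind}_{C(X)G_{[0,\frac12],\ell}}^{K}\varphi\Psi_X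 ,$$ which is an irreducible representation of $K$ of depth $2\ell$ and degree $\frac12q^{2\ell-1}(q^2-1)$. For $u\in\{1,\varepsilon\}$, $C(X_{u,0})=\left\{\pm\begin{pmatrix}1&b\\ 0&1\end{pmatrix}: b\in\mathcal{R}\right\}$; a character $\vartheta$ of $Z$ is viewed as a character of $C(X_{u,0})$ by letting it be trivial on the upper triangular unipotent matrices, and this gives the meaning of $\mathcal{S}_d(\vartheta,X_{u,0})$. *)

(* Defs.v *)
From HB Require Import structures.
From mathcomp Require Import all_boot all_order all_algebra.
From mathcomp Require Export complex.
From mathcomp Require Import boolp classical_sets functions reals ereal.

Set Implicit Arguments.
Unset Strict Implicit.
Unset Printing Implicit Defensive.

Import Order.TTheory GRing.Theory Num.Theory.

Local Open Scope classical_set_scope.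
Local Open Scope ring_scope.

(** * p-adic fields *)

Section PadicField.
Variable (k : fieldType) (val : k -> \bar int).

(* The fractional ideal P^n; P^0 is the ring of integers. *)
Definition frac_ideal (n : int) : set k := [set x | (n%:E <= val x)%E].

(* A p-adic field is a field of characteristic 0, complete for a discrete
   valuation, with finite residue field; val is the normalized valuation and p
   the residual characteristic.  These are exactly the finite extensions of the
   field of p-adic numbers. *)
Record is_padic_field (p : nat) : Prop := IsPadicField {
  padic_prime : prime p;
  padic_char0 : [pchar k] =i pred0;
  padic_val_pinfty : forall x, val x = +oo%E <-> x = 0;
  padic_val_ninfty : forall x, val x <> -oo%E;
  padic_valM : forall x y, val (x * y) = (val x + val y)%E;
  padic_valD : forall x y, (Order.min (val x) (val y) <= val (x + y))%E;
  padic_val_normalized : exists x, val x = 1%:E;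
  padic_complete : forall u : nat -> k,
    (forall n : int, exists N, forall i j,
       (N <= i)%N -> (N <= j)%N -> frac_ideal n (u i - u j)) ->
    exists l, forall n : int, exists N, forall i,
       (N <= i)%N -> frac_ideal n (u i - l);
  padic_residue_finite : exists s : seq k, forall x, frac_ideal 0 x ->
    exists2 y, y \in s & frac_ideal 1 (x - y);
  padic_residue_char : frac_ideal 1 p%:R
}.

Definition is_square (x : k) : Prop := exists y, x = y ^+ 2.

End PadicField.

(** * The group SL_2(k) *)

Section SL2.
Variable k : fieldType.

Record SL2 := MkSL2 { SL2mx :> 'M[k]_2; SL2_det : \det SL2mx == 1 }.

HB.instance Definition _ := [isSub for SL2mx].
HB.instance Definition _ := [Choice of SL2 by <:].

Fact SL2_one_subproof : \det (1%:M : 'M[k]_2) == 1.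
Proof. by rewrite det1. Qed.

Fact SL2_mul_subproof (g h : SL2) : \det (g *m h) == 1.
Proof. by rewrite det_mulmx (eqP (SL2_det g)) (eqP (SL2_det h)) mul1r. Qed.

Fact SL2_inv_subproof (g : SL2) : \det (invmx g) == 1.
Proof. by rewrite det_inv (eqP (SL2_det g)) invr1. Qed.

Definition SL2_one := MkSL2 SL2_one_subproof.
Definition SL2_mul g h := MkSL2 (SL2_mul_subproof g h).
Definition SL2_inv g := MkSL2 (SL2_inv_subproof g).

Fact SL2_unitmx (g : SL2) : (g : 'M_2) \in unitmx.
Proof. by rewrite unitmxE (eqP (SL2_det g)) unitr1. Qed.

Fact SL2_mulA : associative SL2_mul.
Proof. by move=> f g h; apply/val_inj; rewrite /= mulmxA. Qed.

Fact SL2_mul1 : left_id SL2_one SL2_mul.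
Proof. by move=> g; apply/val_inj; rewrite /= mul1mx. Qed.

Fact SL2_mulr1 : right_id SL2_one SL2_mul.
Proof. by move=> g; apply/val_inj; rewrite /= mulmx1. Qed.

Fact SL2_mulV : left_inverse SL2_one SL2_inv SL2_mul.
Proof. by move=> g; apply/val_inj; rewrite /= mulVmx ?SL2_unitmx. Qed.

Fact SL2_mulrV : right_inverse SL2_one SL2_inv SL2_mul.
Proof. by move=> g; apply/val_inj; rewrite /= mulmxV ?SL2_unitmx. Qed.

HB.instance Definition _ := isGroup.Build SL2
  SL2_mulA SL2_mul1 SL2_mulr1 SL2_mulV SL2_mulrV.

End SL2.

(** * Representations *)

(* As in mxrepresentation, a representation of a subgroup H is handled as an
   H-stable subspace W of a representation rho of the ambient group G.  Thus
   Res_H rho is rho itself, considered through its H-stable subspaces. *)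
Section Representations.
Variables (C : fieldType) (G : groupType).

Definition is_rep (V : lmodType C) (rho : G -> {linear V -> V}) : Prop :=
  (forall v, rho 1%g v = v) /\
  (forall g h v, rho (g * h)%g v = rho g (rho h v)).

Section Subrepresentations.
Variables (H : set G) (V : lmodType C) (rho : G -> {linear V -> V}).

Definition subrep (W : set V) : Prop :=
  [/\ W 0, (forall a v w, W v -> W w -> W (a *: v + w)) &
      (forall h v, H h -> W v -> W (rho h v))].

Definition irreducible_subrep (W : set V) : Prop :=
  [/\ subrep W, (exists2 v, W v & v <> 0) &
      (forall W', subrep W' -> W' `<=` W -> W' = [set 0] \/ W' = W)].

Definition has_fixed_vector (W : set V) : Prop :=
  exists v, [/\ W v, v <> 0 & forall h, H h -> rho h v = v].

End Subrepresentations.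

Definition rep_iso (H : set G)
    (V : lmodType C) (rho : G -> {linear V -> V}) (W : set V)
    (V' : lmodType C) (rho' : G -> {linear V' -> V'}) (W' : set V') : Prop :=
  exists T : V -> V',
    [/\ (forall a v w, W v -> W w -> T (a *: v + w) = a *: T v + T w),
        set_bij W W' T &
        (forall h v, H h -> W v -> T (rho h v) = rho' h (T v))].

Definition right_translation (g : G) (f : G -> C^o) : G -> C^o :=
  fun x => f (x * g)%g.

Fact right_translation_is_linear g : linear (right_translation g).
Proof. by []. Qed.

HB.instance Definition _ g :=
  GRing.isLinear.Build C (G -> C^o) (G -> C^o) *:%R (right_translation g)
    (right_translation_is_linear g).

Definition right_regular (g : G) : {linear (G -> C^o) -> (G -> C^o)} :=
  right_translation g.

(* The space of Ind_J^H chi, on which H acts by right translation: functions on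
   H, extended by 0 to G.  No smoothness is imposed on these functions: it is
   automatic when J is open in H, H is compact and chi is smooth. *)
Definition ind_space (J H : set G) (chi : G -> C) : set (G -> C^o) :=
  [set f | (forall x, ~ H x -> f x = 0) /\
           (forall j h, J j -> H h -> f (j * h)%g = chi j * f h)].

Definition prod_set (A B : set G) : set G := [set (a * b)%g | a in A & b in B].

(* The function a * b |-> phi a * psi b on the product A B, whenever this is
   well defined. *)
Definition prod_char (A : set G) (phi : G -> C) (B : set G) (psi : G -> C)
    (x : G) : C :=
  xget 0 [set z | exists a b,
            [/\ A a, B b, x = (a * b)%g & z = phi a * psi b]].

End Representations.

(** * Subgroups of SL_2(k), depth and Shalika's representations *)

Section Depth.
Variables (R : realType) (k : fieldType) (val : k -> \bar int).
Local Notation C := R[i].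
Local Notation G := (SL2 k).
Local Notation "''P^' n" := (frac_ideal val n) (at level 2).

Definition max_compact : set G := [set g | forall i j, 'P^0 (g i j)].

Definition SL2_center : set G :=
  [set g | (g : 'M_2) = 1%:M \/ (g : 'M_2) = - 1%:M].

(* The groups G_{x,r} and G_{x,r+} are obtained for rnd the functions
   t |-> least integer >= t, and t |-> least integer > t, respectively. *)
Definition filtration (rnd : R -> int) (x r : R) : set G :=
  [set g | [/\ 'P^(rnd r) (g 0 0 - 1), 'P^(rnd (r - x)) (g 0 1),
               'P^(rnd (r + x)) (g 1 0) & 'P^(rnd r) (g 1 1 - 1)]].

Definition Gxr : R -> R -> set G := filtration Num.ceil.

Definition Gxr_plus : R -> R -> set G :=
  filtration (fun t => Num.floor t + 1).

Definition centralizer_in_K (X : 'M[k]_2) : set G :=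
  [set g | max_compact g /\ g *m X = X *m g].

Definition smooth (V : lmodType C) (rho : G -> {linear V -> V}) : Prop :=
  forall v, exists n : int, forall g : G,
    (forall i j, 'P^n (((g : 'M_2) - 1%:M) i j)) -> rho g v = v.

Definition is_minimum (A : set R) (r : R) : Prop := A r /\ lbound A r.

Definition is_depth (V : lmodType C) (rho : G -> {linear V -> V})
    (W : set V) (r : R) : Prop :=
  is_minimum [set t | 0 <= t /\
    exists x : R, has_fixed_vector (Gxr_plus x t) rho W] r.

Definition is_depth_K (V : lmodType C) (rho : G -> {linear V -> V})
    (W : set V) (r : R) : Prop :=
  is_minimum [set t | 0 <= t /\
    has_fixed_vector (Gxr_plus 0 t) rho W] r.

Definition central_character (V : lmodType C) (rho : G -> {linear V -> V})
    (theta : G -> C) : Prop :=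
  forall z v, SL2_center z -> rho z v = theta z *: v.

Definition antidiag (u v : k) : 'M[k]_2 :=
  \matrix_(i, j) (if i == j then 0 else if i == 0 then u else v).

Variables (varpi : k) (Psi : k -> C).

(* The level l is a positive half-integer; below, d is the integer 2 l. *)
Definition G_edge (d : int) : set G :=
  \bigcap_(x in [set x : R | 0 <= x <= 1 / 2]) Gxr x (d%:~R / 2).

Definition Psi_X (d : int) (X : 'M[k]_2) (z : G) : C :=
  Psi (varpi ^ (- d) * \tr (X *m ((z : 'M_2) - 1%:M))).

(* S_d(phi, X), as a subspace of the right regular representation.  Intended
   for d > 0, X = antidiag u v with val v > val u = 0, and phi a character of
   C(X) agreeing with Psi_X on the intersection of C(X) and G_edge d. *)
Definition shalika (d : int) (phi : G -> C) (X : 'M[k]_2) : set (G -> C^o) :=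
  ind_space (prod_set (centralizer_in_K X) (G_edge d)) max_compact
    (prod_char (centralizer_in_K X) phi (G_edge d) (Psi_X d X)).

Definition unipotent_K : set G :=
  [set g | [/\ max_compact g, g 0 0 = 1, g 1 0 = 0 & g 1 1 = 1]].

(* A character of the center, viewed as a character of C(X_{u,0}). *)
Definition inflate_central (theta : G -> C) : G -> C :=
  prod_char SL2_center theta unipotent_K (fun=> 1).

End Depth.

(* Main.v *)
(* Put c = ceil(d/2) and m = floor(d/2) + 1, so that c + m = d + 1, and let W
   be an irreducible component of Res_K pi of depth d > 2r.
   A vector of pi fixed by some G_{x,r+} generates pi, so W contains a nonzero
   vector fixed by K and g.G_{x,r+}.g^-1 for some g, that is, after moving g.x
   by K, by the intersection of K with G_{y,r+} for some y >= 0.  As W has no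
   vector fixed by G_{0,d}, y >= d - r > r, so this vector is fixed by all upper
   unipotents of K, by the diagonal matrices congruent to 1 mod P^c and by
   G_{0,d+}.  Fourier analysis along the lower unipotents with entry in
   P^m / P^(d+1) turns it into an eigenvector with character
   Psi(varpi^-d u g_10); here u is a unit, for otherwise G_{0,d} would fix it,
   and conjugating by a diagonal matrix reduces u modulo squares.  Together with
   the central character this is the inducing character of S_d(theta, X_{u,0}),
   and Frobenius reciprocity with Mackey's criterion concludes. *)

(* The bound d > 2r enters twice: it gives floor(r) + 1 <= c, so diagonal matrices of K congruent to
   1 mod P^c lie in G_{y,r+}; and it turns y >= d - r into y > r, so the exponent floor(r - y) + 1
   of the upper right entry is at most 0. Invariance under all integral upper unipotents is what
   leads to v = 0 in X_{u,v}. The equality c + m = d + 1 also works twice: an off-diagonal entry in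
   P^m times a diagonal error in P^c is invisible to Psi(varpi^-d .), so the inducing character is
   multiplicative; and R/P^c is the dual of P^m/P^(d+1), so the frequency u is integral. The space
   of pi is an abstract vector space without invariant form or measure, and Res_K pi is never
   decomposed: linear projections and functionals are averaged over finite quotients by groups
   G_{0,n}. Irreducibility of S_d is not an input. Mackey's condition confines the image of the
   eigenvector to the inducing subgroup, and the translates of this one function span the induced
   space, so the Frobenius map is onto. *)
Require Import Defs.
From mathcomp Require Import all_boot all_order all_algebra.
From mathcomp Require Import zify ring lra.
From mathcomp Require Import boolp classical_sets functions reals ereal.

Set Implicit Arguments.
Unset Strict Implicit.
Unset Printing Implicit Defensive.

Import Order.TTheory GRing.Theory Num.Theory.

Local Open Scope classical_set_scope.
Local Open Scope ring_scope.

(** * Fractional ideals *)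

Section Valuation.
Variables (k : fieldType) (val : k -> \bar int) (p : nat).
Hypothesis hk : is_padic_field val p.
Local Notation "''P^' n" := (frac_ideal val n) (at level 2).

Lemma val_finite x : x != 0 -> exists n : int, val x = n%:E.
Proof.
move=> /eqP x0; case E: (val x) => [n||]; first by exists n.
  by case: x0; apply/(padic_val_pinfty hk).
by case: (padic_val_ninfty hk E).
Qed.

Lemma frac_ideal0 n : 'P^n 0.
Proof.
by rewrite /frac_ideal /= (proj2 (padic_val_pinfty hk 0) erefl) leey.
Qed.

Lemma frac_idealW m n x : m <= n -> 'P^n x -> 'P^m x.
Proof. by move=> mn; rewrite /frac_ideal /=; apply: le_trans; rewrite lee_fin. Qed.

Lemma frac_idealD n x y : 'P^n x -> 'P^n y -> 'P^n (x + y).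
Proof.
rewrite /frac_ideal /= => hx hy; apply: le_trans (padic_valD hk x y).
by rewrite le_min hx hy.
Qed.

Lemma val_one : val 1 = 0%:E.
Proof.
have [n En] := val_finite (oner_neq0 k).
have := padic_valM hk 1 1; rewrite mulr1 En -EFinD => -[E]; congr (_%:E); lia.
Qed.

Lemma val_oppone : val (-1) = 0%:E.
Proof.
have [n En] : exists n : int, val (-1) = n%:E.
  by apply: val_finite; rewrite oppr_eq0 oner_eq0.
have := padic_valM hk (-1) (-1).
by rewrite mulrNN mulr1 En val_one -EFinD => -[E]; congr (_%:E); lia.
Qed.

Lemma frac_ideal_mul m n x y : 'P^m x -> 'P^n y -> 'P^(m + n) (x * y).
Proof.
rewrite /frac_ideal /= => hx hy.
by rewrite (padic_valM hk) EFinD leeD.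
Qed.

Lemma frac_ideal1 : 'P^0 1.
Proof. by rewrite /frac_ideal /= val_one. Qed.

Lemma frac_idealN n x : 'P^n x -> 'P^n (- x).
Proof.
by rewrite -mulN1r -{2}[n]add0r; apply: frac_ideal_mul; rewrite /frac_ideal /= val_oppone.
Qed.

Lemma frac_idealB n x y : 'P^n x -> 'P^n y -> 'P^n (x - y).
Proof. by move=> hx hy; apply: frac_idealD => //; apply: frac_idealN. Qed.

Lemma frac_idealBC n x y : 'P^n (x - y) -> 'P^n (y - x).
Proof. by rewrite -[y - x]opprB => /frac_idealN. Qed.

Lemma frac_idealMl n x y : 'P^0 x -> 'P^n y -> 'P^n (x * y).
Proof. by rewrite -{2}[n]add0r; apply: frac_ideal_mul. Qed.

Lemma frac_idealMr n x y : 'P^n x -> 'P^0 y -> 'P^n (x * y).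
Proof. by rewrite -{2}[n]addr0; apply: frac_ideal_mul. Qed.

Lemma frac_ideal_inter x : (forall n : nat, 'P^n%:Z x) -> x = 0.
Proof.
move=> h; apply: contrapT => /eqP /val_finite [n En].
by have := h (absz (n + 1)); rewrite /frac_ideal /= En lee_fin; lia.
Qed.

Lemma frac_ideal_ge x n m : val x = n%:E -> 'P^m x <-> m <= n.
Proof. by rewrite /frac_ideal /= => ->; rewrite lee_fin. Qed.

Lemma val_inv x n : val x = n%:E -> val x^-1 = (- n)%:E.
Proof.
move=> En; have x0 : x != 0.
  by apply/eqP => /(padic_val_pinfty hk); rewrite En.
have [m Em] : exists m : int, val x^-1 = m%:E by apply: val_finite; rewrite invr_eq0.
have := padic_valM hk x x^-1; rewrite divff // val_one En Em -EFinD => -[E].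
by congr (_%:E); lia.
Qed.

Lemma val_mul x y n m : val x = n%:E -> val y = m%:E -> val (x * y) = (n + m)%:E.
Proof. by rewrite (padic_valM hk) => -> ->. Qed.

Lemma val_or0 x : (exists n : int, x != 0 /\ val x = n%:E) \/ x = 0.
Proof.
have [->|x0] := eqVneq x 0; first by right.
by left; have [n ?] := val_finite x0; exists n.
Qed.

Lemma val_neq0 x n : val x = n%:E -> x != 0.
Proof. by move=> En; apply/eqP => /(padic_val_pinfty hk); rewrite En. Qed.

Lemma not_frac_ideal x n : ~ 'P^n x -> exists2 m : int, val x = m%:E & m < n.
Proof.
case: (val_or0 x) => [[m [_ Em]]|->]; last by case; apply: frac_ideal0.
by rewrite (frac_ideal_ge _ Em) => h; exists m => //; lia.
Qed.

Lemma unit_val x : 'P^0 x -> ~ 'P^1 x -> val x = 0%:E.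
Proof. by move=> h /not_frac_ideal[m E h1]; rewrite E; move: h; rewrite (frac_ideal_ge _ E) => h; congr (_%:E); lia. Qed.

Lemma frac_ideal_divl n m x y : val y = m%:E -> 'P^n (y * x) <-> 'P^(n - m) x.
Proof.
move=> Ey; split=> h.
  have := frac_ideal_mul (n := - m) (y := y^-1) h; rewrite mulrAC divff ?mul1r; last exact: val_neq0 Ey.
  by apply; rewrite (frac_ideal_ge _ (val_inv Ey)).
rewrite -[n](subrK m) addrC; apply: frac_ideal_mul => //.
by rewrite (frac_ideal_ge _ Ey).
Qed.

Lemma val_cong1 x n : 0 < n -> 'P^n (x - 1) -> val x = 0%:E.
Proof.
move=> n0 h; apply: unit_val.
  by rewrite -[x](subrK 1); apply: frac_idealD frac_ideal1; apply: frac_idealW h; lia.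
move=> h1; have : 'P^1 (x - (x - 1)) by apply: frac_idealB => //; apply: frac_idealW h; lia.
by rewrite opprB addrC subrK (frac_ideal_ge _ val_one).
Qed.

Lemma not_frac_ideal1 n : 0 < n -> ~ 'P^n 1.
Proof. by move=> n0; rewrite (frac_ideal_ge _ val_one) => h; lia. Qed.

Lemma val_expz x (n : int) : val x = 1%:E -> val (x ^ n) = n%:E.
Proof.
move=> Ex; have nat_case (j : nat) : val (x ^+ j) = (j%:Z)%:E.
  elim: j => [|j IH]; first by rewrite expr0 val_one.
  by rewrite exprS (val_mul Ex IH); congr (_%:E); lia.
case: n => j; first exact: nat_case.
by rewrite [in RHS]NegzE; exact: val_inv (nat_case j.+1).
Qed.

(** Since p = 1 + 2 floor(p/2) lies in P, having 2 in P would put 1 in P. *)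
Lemma val2 : odd p -> val 2%:R = 0%:E.
Proof.
move=> op; apply: unit_val.
  by rewrite mulr2n; apply: frac_idealD; apply: frac_ideal1.
have nat_int (j : nat) : 'P^0 j%:R.
  elim: j => [|j IH]; first exact: frac_ideal0.
  by rewrite -addn1 natrD; apply: frac_idealD IH frac_ideal1.
move=> h; apply: (@not_frac_ideal1 1) => //.
have := padic_residue_char hk; rewrite -[p in p%:R]odd_double_half op -muln2 natrD natrM => hp.
have -> : 1 = (1 + p./2%:R * 2%:R) - p./2%:R * 2%:R :> k by rewrite addrK.
apply: frac_idealB => //.
exact: frac_idealMl.
Qed.

(** Induction on digits: a class modulo P^n splits according to the residue of the next digit,
    whence the candidates a + w^n b. *)
Lemma residue_reps (n : nat) : exists s : seq k,
  forall x, 'P^0 x -> exists2 y, y \in s & 'P^n%:Z (x - y).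
Proof.
have [w Ew] := padic_val_normalized hk.
have [s0 hs0] := padic_residue_finite hk.
elim: n => [|n [s hs]].
  by exists [:: 0] => x hx; exists 0; rewrite ?mem_head ?subr0.
exists [seq a + w ^+ n * b | a <- s, b <- s0] => x /hs [a as_ xa].
have Ewn : val (w ^+ n) = (n%:Z)%:E by apply: (@val_expz w n).
have wn0 := val_neq0 Ewn.
have xaE : x - a = w ^+ n * ((x - a) / w ^+ n) by rewrite mulrCA divff // mulr1.
have /hs0[b bs0 hb] : 'P^0 ((x - a) / w ^+ n).
  by move: xa; rewrite {1}xaE (frac_ideal_divl _ _ Ewn) subrr.
exists (a + w ^+ n * b); first by apply/allpairsP; exists (a, b).
have -> : x - (a + w ^+ n * b) = w ^+ n * ((x - a) / w ^+ n - b).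
  by rewrite mulrBr -xaE opprD addrA.
by rewrite (frac_ideal_divl _ _ Ewn); apply: frac_idealW hb; lia.
Qed.

End Valuation.

(** * Square classes *)

(** The representative is chosen from the class as a set. Equivalent points have the same class, so
    their representatives are equal, not merely equivalent; [s] only bounds their number. *)
Lemma finite_transversal (T : choiceType) (A : set T) (e : T -> T -> Prop)
    (t0 : T) (s : seq T) :
  (forall x, e x x) -> (forall x y, e x y -> e y x) ->
  (forall x y z, e x y -> e y z -> e x z) ->
  (forall x y, A x -> e x y -> A y) ->
  (forall x, A x -> exists2 y, y \in s & e x y) ->
  exists (r : T -> T) (S : seq T), uniq S /\
    [/\ (forall x, A x -> r x \in S), (forall x, e x (r x)),
        (forall x, x \in S -> A x /\ r x = x) &
        (forall x y, r x = r y <-> e x y)].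
Proof.
move=> e1 eC eT eA eS; pose r x := xget t0 [set y | e x y].
have er x : e x (r x) by rewrite /r; case: xgetP => // /(_ x); case.
have rP x y : r x = r y <-> e x y.
  split=> [rxy|exy]; first by apply: eT (er x) _; rewrite rxy; apply: eC.
  rewrite /r; congr xget; apply/seteqP; split=> z /=; last exact: eT.
  by apply: eT; apply: eC.
exists r, (undup [seq r y | y <- s & `[<A y>]]); split; first exact: undup_uniq.
split=> //.
- move=> x Ax; rewrite mem_undup; have [y ys exy] := eS x Ax.
  apply/mapP; exists y; last exact/rP.
  by rewrite mem_filter ys andbT; apply/asboolP; apply: eA exy.
- move=> x; rewrite mem_undup => /mapP[y]; rewrite mem_filter => /andP[/asboolP Ay _] ->.
  by split; [apply: eA (er y)|apply/rP/eC].
Qed.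

Section SquareClasses.
Variables (k : fieldType) (val : k -> \bar int) (p : nat).
Hypothesis hk : is_padic_field val p.
Hypothesis p_odd : odd p.
Local Notation "''P^' n" := (frac_ideal val n) (at level 2).

(** Newton's iteration [F] for y^2 = u started at [y0]; odd residual characteristic makes the
    denominators 2y units. *)
Lemma hensel_sqrt (u y0 : k) : val u = 0%:E -> 'P^1 (u - y0 ^+ 2) -> is_square u.
Proof.
move=> Eu hy0; pose F (y : k) := y - (y ^+ 2 - u) / (2%:R * y).
pose y n := iter n F y0; have E2 := val2 hk p_odd.
have two0 := val_neq0 hk E2.
have step n x : 0 < n -> 'P^n (x ^+ 2 - u) ->
    [/\ val x = 0%:E, 'P^n (F x - x) & 'P^(n + n) (F x ^+ 2 - u)].
  move=> n0 hx.
  have Ex2 : val (x ^+ 2 / u) = 0%:E.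
    apply: (val_cong1 hk n0); have u0 := val_neq0 hk Eu.
    rewrite -[1 : k](divff u0) -mulrBl; apply: (frac_idealMr hk) hx _.
    by rewrite (frac_ideal_ge _ (val_inv hk Eu)).
  have Ex : val x = 0%:E.
    have : val (x ^+ 2) = 0%:E.
      by rewrite -[x ^+ 2](divfK (val_neq0 hk Eu)) (val_mul hk Ex2 Eu) addr0.
    have [[m [_ Em]]|->] := val_or0 hk x.
      by rewrite expr2 (val_mul hk Em Em) Em => -[E]; congr (_%:E); lia.
    by rewrite expr2 mulr0.
  have x0 := val_neq0 hk Ex.
  have hq : 'P^n ((x ^+ 2 - u) / (2%:R * x)).
    apply: (frac_idealMr hk) hx _.
    by rewrite (frac_ideal_ge _ (val_inv hk (val_mul hk E2 Ex))).
  split=> //; first by rewrite /F addrAC subrr sub0r; apply: (frac_idealN hk).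
  (* A Newton step squares the error up to a unit, so the exponent doubles. *)
  have -> : F x ^+ 2 - u = ((x ^+ 2 - u) / (2%:R * x)) ^+ 2.
    by rewrite /F; field; rewrite x0 two0.
  by rewrite expr2; apply: (frac_ideal_mul hk).
(* A gain of one exponent per step is all that is kept; it suffices for the Cauchy property. *)
have yP (n : nat) : 'P^(n.+1%:Z) (y n ^+ 2 - u).
  elim: n => [|n IH]; first exact: (frac_idealBC hk).
  have [//|_ _] := step n.+1%:Z _ _ IH.
  by apply: (frac_idealW); lia.
have ydiff (n m : nat) : 'P^(n.+1%:Z) (y (m + n)%N - y n).
  elim: m => [|m IH]; first by rewrite subrr; apply: (frac_ideal0 hk).
  rewrite -[_ - _](subrKA (y (m + n)%N)); apply: (frac_idealD hk) IH.
  have [//|_ + _] := step (m + n).+1%:Z _ _ (yP (m + n)%N).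
  by apply: frac_idealW; lia.
have [|l hl] := padic_complete hk (u := y).
  move=> n; exists (absz n) => i j ni nj.
  have d0 (a : nat) : (absz n <= a)%N -> 'P^n (y a - y (absz n)).
    by move=> na; rewrite -(subnK na); apply: frac_idealW (ydiff _ _); lia.
  by rewrite -(subrKA (y (absz n))); apply: (frac_idealD hk); [exact: d0|apply: (frac_idealBC hk); exact: d0].
exists l; apply/eqP; rewrite -subr_eq0; apply/eqP.
apply: (frac_ideal_inter hk) => n.
have [N hN] := hl n%:Z; pose i := (N + n)%N.
have h1 : 'P^n%:Z (y i - l) by apply: hN; rewrite leq_addr.
have h2 : 'P^n%:Z (y i ^+ 2 - u) by apply: frac_idealW (yP i); lia.
have [//|Ey _ _] := step i.+1%:Z _ _ (yP i).
have yi0 : 'P^0 (y i) by rewrite (frac_ideal_ge _ Ey).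
have -> : u - l ^+ 2 = (y i - l) * (y i + (y i - (y i - l))) - (y i ^+ 2 - u) by ring.
apply: (frac_idealB hk) h2; apply: (frac_idealMr hk) => //.
apply: (frac_idealD hk) => //; apply: (frac_idealB hk) => //.
by apply: frac_idealW h1; lia.
Qed.

(** Counting replaces the structure of the residue field's unit group. With [S] the unit residues
    and [Sq] the squares among them, |S| <= 2|Sq|; a unit u in neither class would give 1 + 2|Sq| <=
    |S|. *)
Lemma square_classes (epsilon u : k) : val epsilon = 0%:E -> ~ is_square epsilon ->
  val u = 0%:E -> is_square u \/ exists y, u = epsilon * y ^+ 2.
Proof.
move=> Ee nsq Eu; apply: contrapT => /not_orP[nu1 nu2].
have [s hs] := residue_reps hk 1%N.
have [|||||r [S [uS [rS er SP rP]]]] :=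
  @finite_transversal k [set x | val x = 0%:E] (fun x y => 'P^1 (x - y)) 0 s.
- by move=> x; rewrite subrr; apply: (frac_ideal0 hk).
- by move=> x y; apply: (frac_idealBC hk).
- by move=> x y z xy yz; rewrite -(subrKA y); apply: (frac_idealD hk).
- move=> x y /= Ex xy; have x0 := val_neq0 hk Ex.
  rewrite -[y](divfK x0) (val_mul hk _ Ex (n := 0)) ?addr0 //.
  apply: (val_cong1 hk (n := 1)) => //.
  rewrite -[1 : k](divff x0) -mulrBl; apply: (frac_idealMr hk).
    exact: (frac_idealBC hk).
  by rewrite (frac_ideal_ge _ (val_inv hk Ex)).
- by move=> x Ex; apply: hs; rewrite (frac_ideal_ge _ Ex).
rewrite /= in rS SP.
have P0 x : val x = 0%:E -> 'P^0 x by move=> E; rewrite (frac_ideal_ge _ E).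
have unit2 x : val x = 0%:E -> val (x ^+ 2) = 0%:E.
  by move=> Ex; rewrite expr2 (val_mul hk Ex Ex).
pose f x := r (x ^+ 2); pose Sq := undup (map f S).
have SqP z : z \in Sq -> exists2 x, x \in S & z = f x.
  by rewrite mem_undup => /mapP[x]; exists x.
have SqS z : z \in Sq -> z \in S.
  by move=> /SqP[x /SP[Ex _] ->]; apply/rS/unit2.
(* A residue is determined up to sign by its square: if x' - x is a unit and x'^2 - x^2 lies in P,
   then x' + x lies in P. Here [g] selects one root for each square. *)
have le1 : (size S <= size Sq + size Sq)%N.
  pose g z := xget 0 [set x | x \in S /\ f x = z].
  suff : (size S <= size (map g Sq ++ map (fun z => r (- g z)) Sq))%N.
    by rewrite size_cat !size_map.
  apply: uniq_leq_size => // x xS; have [Ex rx] := SP x xS.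
  have fxS : f x \in Sq by rewrite mem_undup; apply: map_f.
  have [gS fg] : g (f x) \in S /\ f (g (f x)) = f x.
    by rewrite /g; case: xgetP => [? -> //|/(_ x)[]].
  have [Eg rg] := SP _ gS.
  have /rP := fg; set x' := g (f x) in gS fg Eg rg *.
  rewrite mem_cat => hxx; apply/orP.
  have [h|h] := pselect ('P^1 (x' - x)).
    left; apply/mapP; exists (f x) => //.
    by rewrite -{1}rx -[g _]rg; apply/rP; apply: (frac_idealBC hk).
  right; apply/mapP; exists (f x) => //; rewrite -{1}rx; apply/rP.
  have Ed : val (x' - x) = 0%:E.
    by apply: (unit_val hk) => //; apply: (frac_idealB hk); apply: P0.
  rewrite opprK addrC -[1 : int]subr0.
  by rewrite -(frac_ideal_divl hk 1 _ Ed) -subr_sqr.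
(* The listed residues are distinct: by Hensel, a coincidence would make u, u / epsilon or epsilon a
   square. *)
have le2 : (size (r u :: Sq ++ map (fun z => r (epsilon * z)%R) Sq) <= size S)%N.
  have Sqe z : z \in Sq -> val (epsilon * z) = 0%:E.
    by move=> /SqS/SP[Ez _]; rewrite (val_mul hk Ee Ez).
  have hens a b c : val a = 0%:E -> val b = 0%:E ->
    'P^1 (a * b ^+ 2 - c ^+ 2) -> is_square a.
    move=> Ea Eb h; apply: (hensel_sqrt (y0 := c / b)) => //.
    have -> : a - (c / b) ^+ 2 = (b ^-1 ^+ 2) * (a * b ^+ 2 - c ^+ 2).
      by field; rewrite (val_neq0 hk Eb).
    apply: (frac_idealMl hk) => //; apply/P0/unit2.
    by rewrite (val_inv hk Eb) oppr0.
  apply: uniq_leq_size.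
    rewrite cons_uniq cat_uniq undup_uniq /= mem_cat negb_or -!andbA; apply/and4P; split.
    - apply/negP => /SqP[x xS] /rP h; apply: nu1; exact: hensel_sqrt h.
    - apply/negP => /mapP[z /SqP[x /SP[Ex _] ->]] /rP h; apply: nu2.
      have [y hy] : is_square (u / epsilon).
        apply: (hensel_sqrt (y0 := x)); first by rewrite (val_mul hk Eu (val_inv hk Ee)).
        have -> : u / epsilon - x ^+ 2 = epsilon^-1 * ((u - epsilon * f x) - epsilon * (x ^+ 2 - f x)).
          by field; rewrite (val_neq0 hk Ee).
        apply: (frac_idealMl hk); first by rewrite (frac_ideal_ge _ (val_inv hk Ee)).
        by apply: (frac_idealB hk) h _; apply: (frac_idealMl hk) (P0 _ Ee) _; apply: er.
      by exists y; rewrite -hy mulrC divfK ?(val_neq0 hk Ee).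
    - apply/hasPn => w /mapP[z /SqP[x /SP[Ex _] ->] ->]; apply/negP => /SqP[x' x'S /rP h].
      apply: nsq; apply: (hens _ x x') => //.
      have -> : epsilon * x ^+ 2 - x' ^+ 2 = (epsilon * f x - x' ^+ 2) + epsilon * (x ^+ 2 - f x) by ring.
      by apply: (frac_idealD hk) h _; apply: (frac_idealMl hk) (P0 _ Ee) _; apply: er.
    - rewrite map_inj_in_uniq ?undup_uniq // => z z' /SqS zS /SqS z'S /rP.
      rewrite -mulrBr (frac_ideal_divl hk _ _ Ee) subr0 => /rP.
      by rewrite (SP z zS).2 (SP z' z'S).2.
  move=> z; rewrite in_cons mem_cat => /orP[/eqP->|/orP[/SqS//|/mapP[z' z'S ->]]].
    exact: rS.
  by apply: rS; apply: Sqe.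
have := leq_trans le2 le1; rewrite /= size_cat size_map; lia.
Qed.

End SquareClasses.

(** * Complements and coset representatives *)

(** The spaces may be infinite-dimensional and carry no inner product, so a complement of [W] is
    taken maximal among the subspaces meeting [W] trivially. *)
Lemma subspace_projection (F : fieldType) (V : lmodType F) (W : set V) :
  W 0 -> (forall a v w, W v -> W w -> W (a *: v + w)) ->
  exists p : V -> V, [/\ (forall a v w, p (a *: v + w) = a *: p v + p w),
    (forall v, W (p v)) & (forall w, W w -> p w = w)].
Proof.
move=> W0 Wlin.
(* Membership of 0 is left out so that the union of the empty chain qualifies; [A00] recovers it
   from maximality. *)
pose P (M : set V) := (forall a v w, M v -> M w -> M (a *: v + w)) /\
  (forall v, M v -> W v -> v = 0).
have [C FP totF|A [[Alin A0] Amax]] := @Zorn_bigcup V P.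
  split=> [a v w [X CX Xv] [Y CY Yw]|v [X CX Xv]]; last exact: (FP X CX).2.
  have [XY|YX] := totF X Y CX CY.
    by exists Y => //; apply: (FP Y CY).1 => //; apply: XY.
  by exists X => //; apply: (FP X CX).1 => //; apply: YX.
have A00 : A 0.
  apply: contrapT => nA0; apply: (Amax [set 0]).
    split=> [v Av|h]; last exact/nA0/h.
    by case: nA0; rewrite -(addNr v) -scaleN1r; apply: Alin.
  by split=> [a v w -> ->|v ->//]; rewrite /= scaler0 addr0.
have AZ a v : A v -> A (a *: v) by move=> Av; rewrite -[_ *: _]addr0; apply: Alin.
have WZ a v : W v -> W (a *: v) by move=> Wv; rewrite -[_ *: _]addr0; apply: Wlin.
have AB v w : A v -> A w -> A (v - w).
  by move=> Av Aw; rewrite addrC -scaleN1r; apply: Alin.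
have WB v w : W v -> W w -> W (v - w).
  by move=> Wv Ww; rewrite addrC -scaleN1r; apply: Wlin.
have full v : exists u, W u /\ A (v - u).
  apply: contrapT => nv; apply: (Amax [set x | exists a w, A w /\ x = a *: v + w]).
    split; first by move=> w Aw; exists 0, w; rewrite scale0r add0r.
    move=> /(_ v) h; apply: nv; exists 0; split=> //; rewrite subr0; apply: h.
    by exists 1, 0; rewrite scale1r addr0.
  split=> [a _ _ [b [w [Aw ->]]] [c [w' [Aw' ->]]]|x [a [w [Aw ->]]] Wx].
    exists (a * b + c), (a *: w + w'); split; first exact: Alin.
    by rewrite scalerDr scalerDl scalerA addrACA.
  have [a0|a0] := eqVneq a 0.
    by move: Wx; rewrite a0 scale0r add0r; apply: A0.
  case: nv; exists (a^-1 *: (a *: v + w)); split; first exact: WZ.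
  rewrite scalerDr scalerA mulVf // scale1r opprD addNKr -scaleN1r scalerA.
  exact: AZ.
have [p hp] := choice full.
have uniq_p v u : W u -> A (v - u) -> p v = u.
  move=> Wu Au; have [Wp Ap] := hp v; apply/eqP; rewrite -subr_eq0; apply/eqP.
  apply: A0; last exact: WB.
  by have := AB _ _ Au Ap; rewrite opprB addrC addrA subrK.
exists p; split=> [a v w|v|w Ww]; last 1 first.
- by apply: uniq_p => //; rewrite subrr.
- have [[Wv Av] [Ww Aw]] := (hp v, hp w).
  apply: uniq_p; first exact: Wlin.
  have -> : a *: v + w - (a *: p v + p w) = a *: (v - p v) + (w - p w).
    by rewrite scalerBr opprD addrACA.
  exact: Alin.
- by case: (hp v).
Qed.

Section CosetSums.
Variable G : groupType.
Implicit Types H N : set G.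

Definition is_subgroup H := H 1%g /\ forall x y, H x -> H y -> H (x^-1 * y)%g.

Lemma subgroupV H x : is_subgroup H -> H x -> H (x^-1)%g.
Proof. by move=> [H1 HVM] Hx; rewrite -[(x^-1)%g]mulg1; apply: HVM. Qed.

Lemma subgroupM H x y : is_subgroup H -> H x -> H y -> H (x * y)%g.
Proof.
by move=> HH Hx Hy; rewrite -[x]invgK; apply: HH.2 => //; apply: subgroupV.
Qed.

(** Of a transversal of [H]/[N] only what averaging uses is recorded. The middle clause keeps [S]
    nonempty, hence its size invertible, and quantifying over [M] lets one list average both vectors
    and scalars. *)
Definition coset_reps H N (S : seq G) :=
  [/\ (forall x, x \in S -> H x), (exists2 x, x \in S & N x) &
    forall (M : zmodType) (phi : G -> M),
      (forall x n, H x -> N n -> phi (x * n)%g = phi x) ->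
      forall h, H h -> \sum_(x <- S) phi (h * x)%g = \sum_(x <- S) phi x].

Lemma coset_reps_exist H N (s : seq G) :
  is_subgroup H -> is_subgroup N -> N `<=` H ->
  (forall x, H x -> exists2 y, y \in s & N (x^-1 * y)%g) ->
  exists S, coset_reps H N S.
Proof.
move=> HH HN NH cov.
have [|||||r [S [uS [rS er SP rP]]]] :=
  @finite_transversal G H (fun x y => N (x^-1 * y)%g) 1%g s => //.
- by move=> x; rewrite mulVg; apply: HN.1.
- by move=> x y /(subgroupV HN); rewrite invgM invgK.
- by move=> x y z xy /(subgroupM HN xy); rewrite -mulgA mulVKg.
- by move=> x y Hx /NH /(subgroupM HH Hx); rewrite mulVKg.
have HS x : x \in S -> H x by case/SP.
exists S; split=> //.
  exists (r 1%g); first exact/rS/HH.1.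
  by have := er 1%g; rewrite invg1 mul1g.
move=> M phi phiN h Hh.
transitivity (\sum_(x <- S) phi (r (h * x)%g)).
  rewrite !big_seq; apply: eq_bigr => x /HS Hx.
  have Hhx := subgroupM HH Hh Hx.
  by rewrite -(phiN _ _ Hhx (er (h * x)%g)) mulVKg.
(* Left translation by [h] followed by [r] is an injection of the finite set [S] into itself, hence
   a permutation. *)
rewrite -(big_map (fun x => r (h * x)%g) xpredT phi); apply: perm_big.
have inj : {in S &, injective (fun x => r (h * x)%g)}.
  move=> x y xS yS /rP; rewrite invgM mulgA mulgVK => /rP.
  by rewrite (SP x xS).2 (SP y yS).2.
apply: uniq_perm => //; first by rewrite map_inj_in_uniq.
apply: (uniq_min_size _ _ _).2; rewrite ?map_inj_in_uniq ?size_map //.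
by move=> _ /mapP[x /HS Hx ->]; apply: rS; apply: subgroupM.
Qed.

End CosetSums.

(** * Subgroups of SL_2 *)

Section SL2Entries.
Variable k : fieldType.
Implicit Types (g h : SL2 k) (a b c e : k).

Lemma ord2P (i : 'I_2) : i = 0 \/ i = 1.
Proof. by case: i => -[|[|//]] ?; [left|right]; apply: val_inj. Qed.

Lemma mulmx22 (A B : 'M[k]_2) i j : (A *m B) i j = A i 0 * B 0 j + A i 1 * B 1 j.
Proof.
rewrite mxE !big_ord_recl big_ord0 addr0.
by congr (_ + A _ _ * B _ _); apply: val_inj.
Qed.

Lemma det22 (M : 'M[k]_2) : \det M = M 0 0 * M 1 1 - M 0 1 * M 1 0.
Proof.
rewrite (expand_det_row _ 0) !big_ord_recl big_ord0 addr0.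
rewrite /cofactor !det_mx11 !mxE /= expr0 expr1 mul1r mulN1r mulrN.
by congr (M _ _ * M _ _ - M _ _ * M _ _); apply: val_inj.
Qed.

Lemma SL2_detE g : g 0 0 * g 1 1 - g 0 1 * g 1 0 = 1.
Proof. by rewrite -det22 (eqP (SL2_det g)). Qed.

Lemma SL2_eqP g h : [/\ g 0 0 = h 0 0, g 0 1 = h 0 1, g 1 0 = h 1 0
  & g 1 1 = h 1 1] -> g = h.
Proof.
move=> [e1 e2 e3 e4]; apply/val_inj/matrixP => i j /=.
by case: (ord2P i) (ord2P j) => -> [] ->.
Qed.

Definition mx22 a b c e : 'M[k]_2 :=
  \matrix_(i, j) (if i == 0 then if j == 0 then a else b
                  else if j == 0 then c else e).

Fact SL2_of_subproof a b c e : a * e - b * c = 1 -> \det (mx22 a b c e) == 1.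
Proof. by move=> h; rewrite det22 !mxE /= h. Qed.

Definition SL2_of a b c e (h : a * e - b * c = 1) : SL2 k :=
  MkSL2 (SL2_of_subproof h).

Lemma SL2_ofE a b c e (h : a * e - b * c = 1) :
  ((SL2_of h 0 0 = a) * (SL2_of h 0 1 = b) * (SL2_of h 1 0 = c)
   * (SL2_of h 1 1 = e))%type.
Proof. by rewrite !mxE. Qed.

Lemma SL2_mulE g h i j : (g * h)%g i j = g i 0 * h 0 j + g i 1 * h 1 j.
Proof. exact: mulmx22. Qed.

Lemma SL2_oneE : (((1%g : SL2 k) 0 0 = 1) * ((1%g : SL2 k) 0 1 = 0)
  * ((1%g : SL2 k) 1 0 = 0) * ((1%g : SL2 k) 1 1 = 1))%type.
Proof. by rewrite !mxE. Qed.

Lemma SL2_invE g : (((g^-1)%g 0 0 = g 1 1) * ((g^-1)%g 0 1 = - g 0 1)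
  * ((g^-1)%g 1 0 = - g 1 0) * ((g^-1)%g 1 1 = g 0 0))%type.
Proof.
have h : g 1 1 * g 0 0 - (- g 0 1) * (- g 1 0) = 1 by rewrite -(SL2_detE g); ring.
have -> : (g^-1)%g = SL2_of h; last by rewrite !SL2_ofE.
apply: (mulgI g); rewrite mulgV; apply: SL2_eqP.
rewrite !SL2_mulE !SL2_ofE !SL2_oneE.
by have H := SL2_detE g; split; rewrite -?H; ring.
Qed.

End SL2Entries.

(** Builds a proof that a product lies in the ideal whose exponent is the sum of the bounds found
    for its factors. It commits to one hypothesis per factor; [ideal] then compares exponents with
    [lia]. *)
Ltac ideal_bound t :=
  match t with
  | GRing.mul ?x ?y =>
      let hx := ideal_bound x in let hy := ideal_bound y in
      match goal with hk : is_padic_field _ _ |- _ =>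
        constr:(frac_ideal_mul hk hx hy) end
  | GRing.exp ?x 2 =>
      let hx := ideal_bound x in
      match goal with hk : is_padic_field _ _ |- _ =>
        constr:(frac_ideal_mul hk hx hx) end
  | GRing.opp ?x => let hx := ideal_bound x in
      match goal with hk : is_padic_field _ _ |- _ =>
        constr:(frac_idealN hk hx) end
  | @GRing.one _ => match goal with hk : is_padic_field _ _ |- _ =>
        constr:(frac_ideal1 hk) end
  | @GRing.zero _ => match goal with hk : is_padic_field _ _ |- _ =>
        constr:(frac_ideal0 hk) end
  | _ => match goal with
         | H : frac_ideal _ _ t |- _ => constr:(H)
         | H : frac_ideal _ _ ?y |- _ =>
             let _ := match goal with _ => unify y t end in constr:(H)
         end
  end.

Ltac ideal :=
  lazymatch goal with
  | |- frac_ideal _ _ ?t =>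
    first
    [ by []
    | solve [let h := ideal_bound t in apply: (frac_idealW _ h); lia]
    | match goal with hk : is_padic_field _ _ |- _ =>
        first [ exact (frac_ideal0 hk _)
              | apply (frac_idealB hk); ideal
              | apply (frac_idealD hk); ideal
              | apply (frac_idealN hk); ideal ]
      end ]
  end.

Section Boxes.
Variables (k : fieldType) (val : k -> \bar int) (p : nat).
Hypothesis hk : is_padic_field val p.
Local Notation "''P^' n" := (frac_ideal val n) (at level 2).
Local Notation K := (max_compact val).

(** One shape for all the congruence groups below: G_{0,n}, G_{x,r+}, [G_edge], and the group J
    carrying the inducing character. *)
Definition box (a b c : int) : set (SL2 k) :=
  [set g | [/\ 'P^a (g 0 0 - 1), 'P^b (g 0 1), 'P^c (g 1 0)
             & 'P^a (g 1 1 - 1)]].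

Local Notation Kn n := (box n n n).

Lemma boxP a b c g : box a b c g <-> [/\ 'P^a (g 0 0 - 1), 'P^b (g 0 1),
  'P^c (g 1 0) & 'P^a (g 1 1 - 1)].
Proof. by []. Qed.

Lemma box_sub a b c a' b' c' : a' <= a -> b' <= b -> c' <= c ->
  box a b c `<=` box a' b' c'.
Proof. by move=> ha hb hc g [h1 h2 h3 h4]; split; ideal. Qed.

Lemma cong1_int a (x : k) : 0 <= a -> 'P^a (x - 1) -> 'P^0 x.
Proof. by move=> a0 h; rewrite -[x](subrK 1); ideal. Qed.

(** The condition a <= b + c absorbs the products of off-diagonal entries that appear on the
    diagonal of a product. *)
Lemma box_subgroup a b c : 0 <= a -> a <= b + c -> is_subgroup (box a b c).
Proof.
move=> a0 abc; split.
  by apply/boxP; rewrite !SL2_oneE subrr; split; ideal.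
move=> g h [g1 g2 g3 g4] [h1 h2 h3 h4]; apply/boxP; rewrite !SL2_mulE !SL2_invE.
have g1' := cong1_int a0 g1; have g4' := cong1_int a0 g4.
have h1' := cong1_int a0 h1; have h4' := cong1_int a0 h4.
split; try ideal.
  have -> : g 1 1 * h 0 0 + - g 0 1 * h 1 0 - 1 =
    (g 1 1 - 1) * h 0 0 + (h 0 0 - 1) - g 0 1 * h 1 0 by ring.
  by ideal.
have -> : - g 1 0 * h 0 1 + g 0 0 * h 1 1 - 1 =
  (g 0 0 - 1) * h 1 1 + (h 1 1 - 1) - g 1 0 * h 0 1 by ring.
by ideal.
Qed.

Lemma max_compactE g : K g <-> [/\ 'P^0 (g 0 0), 'P^0 (g 0 1), 'P^0 (g 1 0)
  & 'P^0 (g 1 1)].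
Proof.
split=> [h|[h1 h2 h3 h4] i j]; first by split; apply: h.
by case: (ord2P i) (ord2P j) => -> [] ->.
Qed.

Lemma max_compact_subgroup : is_subgroup K.
Proof.
split; first by apply/max_compactE; rewrite !SL2_oneE; split; ideal.
move=> g h /max_compactE[g1 g2 g3 g4] /max_compactE[h1 h2 h3 h4].
by apply/max_compactE; rewrite !SL2_mulE !SL2_invE; split; ideal.
Qed.

Lemma box_max_compact a b c : 0 <= a -> 0 <= b -> 0 <= c -> box a b c `<=` K.
Proof.
move=> a0 b0 c0 g [h1 h2 h3 h4]; apply/max_compactE; split; try ideal.
  exact: cong1_int h1.
exact: cong1_int h4.
Qed.

Lemma Kn_normal n x g : K x -> Kn n g -> Kn n (x^-1 * g * x)%g.
Proof.
move=> /max_compactE[x1 x2 x3 x4] [g1 g2 g3 g4].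
have E : x 0 0 * x 1 1 = 1 + x 0 1 * x 1 0 by rewrite -(SL2_detE x) subrK.
apply/boxP; rewrite !SL2_mulE !SL2_invE; split.
- have -> : (x 1 1 * g 0 0 + - x 0 1 * g 1 0) * x 0 0 +
    (x 1 1 * g 0 1 + - x 0 1 * g 1 1) * x 1 0 - 1 =
    x 1 1 * (g 0 0 - 1) * x 0 0 + x 1 1 * g 0 1 * x 1 0 - x 0 1 * g 1 0 * x 0 0
    - x 0 1 * (g 1 1 - 1) * x 1 0 by ring: E.
  by ideal.
- have -> : (x 1 1 * g 0 0 + - x 0 1 * g 1 0) * x 0 1 +
    (x 1 1 * g 0 1 + - x 0 1 * g 1 1) * x 1 1 =
    x 1 1 * (g 0 0 - 1) * x 0 1 + x 1 1 * g 0 1 * x 1 1 - x 0 1 * g 1 0 * x 0 1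
    - x 0 1 * (g 1 1 - 1) * x 1 1 by ring.
  by ideal.
- have -> : (- x 1 0 * g 0 0 + x 0 0 * g 1 0) * x 0 0 +
    (- x 1 0 * g 0 1 + x 0 0 * g 1 1) * x 1 0 =
    - x 1 0 * (g 0 0 - 1) * x 0 0 - x 1 0 * g 0 1 * x 1 0 + x 0 0 * g 1 0 * x 0 0
    + x 0 0 * (g 1 1 - 1) * x 1 0 by ring.
  by ideal.
- have -> : (- x 1 0 * g 0 0 + x 0 0 * g 1 0) * x 0 1 +
    (- x 1 0 * g 0 1 + x 0 0 * g 1 1) * x 1 1 - 1 =
    - x 1 0 * (g 0 0 - 1) * x 0 1 - x 1 0 * g 0 1 * x 1 1 + x 0 0 * g 1 0 * x 0 1
    + x 0 0 * (g 1 1 - 1) * x 1 1 by ring: E.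
  by ideal.
Qed.

Lemma Kn_of_cong n (g h : SL2 k) : K g -> 'P^n (g 0 0 - h 0 0) -> 'P^n (g 0 1 - h 0 1) ->
  'P^n (g 1 0 - h 1 0) -> 'P^n (g 1 1 - h 1 1) -> Kn n (g^-1 * h)%g.
Proof.
move=> /max_compactE[g1 g2 g3 g4] d1 d2 d3 d4.
have E : g 0 0 * g 1 1 = 1 + g 0 1 * g 1 0 by rewrite -(SL2_detE g) subrK.
apply/boxP; rewrite !SL2_mulE !SL2_invE; split.
- have -> : g 1 1 * h 0 0 + - g 0 1 * h 1 0 - 1 =
    g 0 1 * (g 1 0 - h 1 0) - g 1 1 * (g 0 0 - h 0 0) by ring: E.
  by ideal.
- have -> : g 1 1 * h 0 1 + - g 0 1 * h 1 1 =
    g 0 1 * (g 1 1 - h 1 1) - g 1 1 * (g 0 1 - h 0 1) by ring.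
  by ideal.
- have -> : - g 1 0 * h 0 0 + g 0 0 * h 1 0 =
    g 1 0 * (g 0 0 - h 0 0) - g 0 0 * (g 1 0 - h 1 0) by ring.
  by ideal.
- have -> : - g 1 0 * h 0 1 + g 0 0 * h 1 1 - 1 =
    g 1 0 * (g 0 1 - h 0 1) - g 0 0 * (g 1 1 - h 1 1) by ring: E.
  by ideal.
Qed.

(** Two elements of [K] with entries congruent modulo P^n differ by G_{0,n}, so the four residues of
    the entries form a finite code that separates cosets. Each code is given an element of [H] with
    that code, or 1 if there is none. *)
Lemma compact_coset_reps (H N : set (SL2 k)) (n : nat) :
  is_subgroup H -> is_subgroup N -> N `<=` H -> H `<=` K ->
  (forall g, H g -> Kn n%:Z g -> N g) -> exists S, coset_reps H N S.
Proof.
move=> HH HN NH HK hn; have [s hs] := residue_reps hk n.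
have [|||||r [S [_ [rS _ _ rP]]]] :=
  @finite_transversal k 'P^0 (fun x y => 'P^n%:Z (x - y)) 0 s => //.
- by move=> x; rewrite subrr; ideal.
- by move=> x y; apply: (frac_idealBC hk).
- by move=> x y z xy yz; rewrite -(subrKA y); ideal.
- by move=> x y hx hxy; rewrite -[y](subKr x); ideal.
pose code (g : SL2 k) := ((r (g 0 0), r (g 0 1)), (r (g 1 0), r (g 1 1))).
pose S2 := [seq (a, b) | a <- S, b <- S].
apply: (@coset_reps_exist _ H N
  [seq xget 1%g [set g | H g /\ code g = c] | c <- [seq (a, b) | a <- S2, b <- S2]]) => //.
move=> g Hg; exists (xget 1%g [set h | H h /\ code h = code g]).
  apply: map_f; have /max_compactE[g1 g2 g3 g4] := HK _ Hg.
  by apply: allpairs_f; apply: allpairs_f; apply: rS.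
case: xgetP => [h _ [Hh [/rP e1 /rP e2 /rP e3 /rP e4]]|/(_ g)]; last by case.
apply: hn; first exact: HH.2.
by apply: Kn_of_cong; [exact: HK|exact: (frac_idealBC hk)..].
Qed.

End Boxes.

Section Elements.
Variable k : fieldType.
Implicit Types (a b c : k).

Fact upper_subproof b : 1 * 1 - b * 0 = 1 :> k. Proof. by ring. Qed.
Definition upper b : SL2 k := SL2_of (upper_subproof b).

Fact lower_subproof c : 1 * 1 - 0 * c = 1 :> k. Proof. by ring. Qed.
Definition lower c : SL2 k := SL2_of (lower_subproof c).

Fact diag_subproof a : a != 0 -> a * a^-1 - 0 * 0 = 1 :> k.
Proof. by move=> a0; rewrite divff // mulr0 subr0. Qed.
Definition diag a (a0 : a != 0) : SL2 k := SL2_of (diag_subproof a0).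

Fact weyl_subproof : 0 * 0 - 1 * (-1) = 1 :> k. Proof. by ring. Qed.
Definition weyl : SL2 k := SL2_of weyl_subproof.

Lemma upperE b : ((upper b 0 0 = 1) * (upper b 0 1 = b) * (upper b 1 0 = 0)
  * (upper b 1 1 = 1))%type.
Proof. by rewrite !SL2_ofE. Qed.

Lemma lowerE c : ((lower c 0 0 = 1) * (lower c 0 1 = 0) * (lower c 1 0 = c)
  * (lower c 1 1 = 1))%type.
Proof. by rewrite !SL2_ofE. Qed.

Lemma diagE a (a0 : a != 0) : ((diag a0 0 0 = a) * (diag a0 0 1 = 0)
  * (diag a0 1 0 = 0) * (diag a0 1 1 = a^-1))%type.
Proof. by rewrite !SL2_ofE. Qed.

Lemma weylE : ((weyl 0 0 = 0) * (weyl 0 1 = 1) * (weyl 1 0 = -1)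
  * (weyl 1 1 = 0))%type.
Proof. by rewrite !SL2_ofE. Qed.

Definition elementsE := (upperE, lowerE, diagE, weylE, SL2_oneE).

Lemma upper_triangular (g : SL2 k) : g 1 0 = 0 -> exists b a (a0 : a != 0),
  g = (upper b * diag a0)%g.
Proof.
move=> g0; have := SL2_detE g; rewrite g0 mulr0 subr0 => E.
have a0 : g 0 0 != 0.
  by apply/eqP => h; move/eqP: E; rewrite h mul0r eq_sym oner_eq0.
exists (g 0 1 * g 0 0), (g 0 0), a0.
have E' : g 1 1 = (g 0 0)^-1 by rewrite -[RHS]mulr1 -E mulKf.
by apply: SL2_eqP; rewrite !SL2_mulE !elementsE g0 E'; split; field.
Qed.

Lemma upper_diag b a (a0 : a != 0) :
  (upper b * diag a0 = diag a0 * upper (b / a ^+ 2))%g.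
Proof. by apply: SL2_eqP; rewrite !SL2_mulE !elementsE; split; field. Qed.

Lemma lower_diag c a (a0 : a != 0) :
  (lower c * diag a0 = diag a0 * lower (c * a ^+ 2))%g.
Proof. by apply: SL2_eqP; rewrite !SL2_mulE !elementsE; split; field. Qed.

(** When b is not integral, b^-1 is, so the left factor can be absorbed into K. *)
Lemma upper_bruhat b (b0 : b != 0) :
  (upper b = lower b^-1 * (diag b0 * weyl) * lower b^-1)%g.
Proof. by apply: SL2_eqP; rewrite !SL2_mulE !elementsE; split; field. Qed.

End Elements.

(** * Points of the apartment *)

Section Apartment.
Variables (R : realType) (k : fieldType) (val : k -> \bar int) (p : nat).
Hypothesis hk : is_padic_field val p.
Local Notation "''P^' n" := (frac_ideal val n) (at level 2).
Local Notation K := (max_compact val).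

Lemma upper_compact b : 'P^0 b -> K (upper b).
Proof. by move=> hb; apply/max_compactE; rewrite !elementsE; split; ideal. Qed.

Lemma lower_compact b : 'P^0 b -> K (lower b).
Proof. by move=> hb; apply/max_compactE; rewrite !elementsE; split; ideal. Qed.

Lemma weyl_compact : K (weyl k).
Proof. by apply/max_compactE; rewrite !elementsE; split; ideal. Qed.

(** Elimination in the first column, pivoting on the entry of smaller valuation so that the quotient
    used is integral. *)
Lemma iwasawa (g : SL2 k) : exists2 h, K h & (h * g)%g 1 0 = 0.
Proof.
have [a0|a0] := eqVneq (g 0 0) 0.
  by exists (weyl k); [exact: weyl_compact|rewrite SL2_mulE !elementsE a0; ring].
have [n En] := val_finite hk a0.
have [h|/(not_frac_ideal hk)[m Em mn]] := pselect ('P^n (g 1 0)).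
  exists (lower (- (g 1 0 / g 0 0))).
    apply: lower_compact; apply: (frac_idealN hk).
    by rewrite mulrC (frac_ideal_divl hk _ _ (val_inv hk En)); apply: frac_idealW h; lia.
  by rewrite SL2_mulE !elementsE; field.
have c0 := val_neq0 hk Em.
have E : 0 * (g 0 0 / g 1 0) - 1 * (-1) = 1 :> k by ring.
exists (SL2_of E); last by rewrite SL2_mulE !SL2_ofE; field.
apply/max_compactE; rewrite !SL2_ofE; split; try ideal.
by rewrite (frac_ideal_ge _ (val_mul hk En (val_inv hk Em))); lia.
Qed.

Definition floor_succ (t : R) : int := Num.floor t + 1.

Lemma floor_succ_le (t u : R) (n : int) : t <= n%:~R + u -> floor_succ t <= n + floor_succ u.
Proof.
move=> h; rewrite /floor_succ addrA lerD2r -lerBlDl floor_ge_int intrB.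
by have := floor_le t; lra.
Qed.

Lemma Gxr_plusP (x r : R) (g : SL2 k) :
  Gxr_plus val x r g <-> box val (floor_succ r) (floor_succ (r - x)) (floor_succ (r + x)) g.
Proof. by []. Qed.

Variable r : R.

(** Stands for g.x = y in the building, without constructing the building. This one inclusion
    already carries vectors fixed by G_{x,r+} to vectors fixed by G_{y,r+} under g. *)
Definition conj_into (g : SL2 k) (x y : R) :=
  forall h, Gxr_plus val y r h -> Gxr_plus val x r (g^-1 * h * g)%g.

Lemma conj_intoM g h x y z :
  conj_into g x y -> conj_into h y z -> conj_into (h * g)%g x z.
Proof.
move=> gxy hyz f /hyz /gxy; congr (Gxr_plus _ _ _ _).
by rewrite invgM !mulgA.
Qed.

Lemma conj_into_diag a (a0 : a != 0) (n : int) (x : R) : val a = n%:E ->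
  conj_into (diag a0) x (x - 2 * n%:~R).
Proof.
move=> En h /Gxr_plusP[h1 h2 h3 h4]; apply/Gxr_plusP/boxP.
rewrite !SL2_mulE !SL2_invE !elementsE; split.
- by have -> : (a^-1 * h 0 0 + - 0 * h 1 0) * a + (a^-1 * h 0 1 + - 0 * h 1 1) * 0 - 1
    = h 0 0 - 1 by field.
- have -> : (a^-1 * h 0 0 + - 0 * h 1 0) * 0 + (a^-1 * h 0 1 + - 0 * h 1 1) * a^-1
    = a^-1 * (a^-1 * h 0 1) by field.
  rewrite !(frac_ideal_divl hk _ _ (val_inv hk En)); apply: frac_idealW h2.
  have : floor_succ (r - x) <= (- n - n) + floor_succ (r - (x - 2 * n%:~R)).
    by apply: floor_succ_le; rewrite intrB intrN; lra.
  lia.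
- have -> : (- 0 * h 0 0 + a * h 1 0) * a + (- 0 * h 0 1 + a * h 1 1) * 0
    = a * (a * h 1 0) by field.
  rewrite !(frac_ideal_divl hk _ _ En); apply: frac_idealW h3.
  have : floor_succ (r + x) <= (n + n) + floor_succ (r + (x - 2 * n%:~R)).
    by apply: floor_succ_le; rewrite intrD; lra.
  lia.
- by have -> : (- 0 * h 0 0 + a * h 1 0) * 0 + (- 0 * h 0 1 + a * h 1 1) * a^-1 - 1
    = h 1 1 - 1 by field.
Qed.

Lemma conj_into_weyl x : conj_into (weyl k) x (- x).
Proof.
move=> h /Gxr_plusP; rewrite opprK => -[h1 h2 h3 h4]; apply/Gxr_plusP/boxP.
rewrite !SL2_mulE !SL2_invE !elementsE; split.
- have -> : (0 * h 0 0 + - 1 * h 1 0) * 0 + (0 * h 0 1 + - 1 * h 1 1) * -1 - 1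
    = h 1 1 - 1 by ring.
  by ideal.
- have -> : (0 * h 0 0 + - 1 * h 1 0) * 1 + (0 * h 0 1 + - 1 * h 1 1) * 0
    = - h 1 0 by ring.
  by ideal.
- have -> : (- -1 * h 0 0 + 0 * h 1 0) * 0 + (- -1 * h 0 1 + 0 * h 1 1) * -1
    = - h 0 1 by ring.
  by ideal.
- have -> : (- -1 * h 0 0 + 0 * h 1 0) * 1 + (- -1 * h 0 1 + 0 * h 1 1) * 0 - 1
    = h 0 0 - 1 by ring.
  by ideal.
Qed.

(** A unipotent in the root subgroup of level at least -x fixes x, so conjugation by it preserves
    the filtration at x. *)
Lemma conj_into_upper b (n : int) x : 'P^n b -> - x <= n%:~R ->
  conj_into (upper b) x x.
Proof.
move=> hb hn h /Gxr_plusP[h1 h2 h3 h4]; apply/Gxr_plusP/boxP.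
have l1 : floor_succ r <= n + floor_succ (r + x) by apply: floor_succ_le; lra.
have l2 : floor_succ (r - x) <= n + floor_succ r by apply: floor_succ_le; lra.
set A := floor_succ (r - x) in h2 l2 *; set B := floor_succ (r + x) in h3 l1 *.
rewrite !SL2_mulE !SL2_invE !elementsE; split.
- have -> : (1 * h 0 0 + - b * h 1 0) * 1 + (1 * h 0 1 + - b * h 1 1) * 0 - 1 =
    (h 0 0 - 1) - b * h 1 0 by ring.
  by ideal.
- have -> : (1 * h 0 0 + - b * h 1 0) * b + (1 * h 0 1 + - b * h 1 1) * 1 =
    h 0 1 + b * (h 0 0 - 1) - b * (h 1 1 - 1) - b * b * h 1 0 by ring.
  by ideal.
- by rewrite mulr0 addr0 mulr1 oppr0 mul0r add0r mul1r.
- have -> : (- 0 * h 0 0 + 1 * h 1 0) * b + (- 0 * h 0 1 + 1 * h 1 1) * 1 - 1 =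
    (h 1 1 - 1) + h 1 0 * b by ring.
  by ideal.
Qed.

Lemma conj_into_lower b (n : int) x : 'P^n b -> x <= n%:~R ->
  conj_into (lower b) x x.
Proof.
move=> hb hn h /Gxr_plusP[h1 h2 h3 h4]; apply/Gxr_plusP/boxP.
have l1 : floor_succ r <= n + floor_succ (r - x) by apply: floor_succ_le; lra.
have l2 : floor_succ (r + x) <= n + floor_succ r by apply: floor_succ_le; lra.
set A := floor_succ (r - x) in h2 l1 *; set B := floor_succ (r + x) in h3 l2 *.
rewrite !SL2_mulE !SL2_invE !elementsE; split.
- have -> : (1 * h 0 0 + - 0 * h 1 0) * 1 + (1 * h 0 1 + - 0 * h 1 1) * b - 1 =
    (h 0 0 - 1) + h 0 1 * b by ring.
  by ideal.
- by rewrite mulr0 add0r mulr1 oppr0 mul0r addr0 mul1r.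
- have -> : (- b * h 0 0 + 1 * h 1 0) * 1 + (- b * h 0 1 + 1 * h 1 1) * b =
    h 1 0 + b * (h 1 1 - 1) - b * (h 0 0 - 1) - b * b * h 0 1 by ring.
  by ideal.
- have -> : (- b * h 0 0 + 1 * h 1 0) * 0 + (- b * h 0 1 + 1 * h 1 1) * 1 - 1 =
    (h 1 1 - 1) - b * h 0 1 by ring.
  by ideal.
Qed.

(* Every point g.x of the building is K-conjugate to a point of the positive
   half of the standard apartment. *)
Lemma conj_into_apartment (g : SL2 k) (x : R) : exists (h : SL2 k) (y : R),
  [/\ K h, 0 <= y & conj_into (h * g)%g x y].
Proof.
suff [h [y [Kh hy]]] : exists h y, K h /\ conj_into (h * g)%g x y.
  have [y0|y0] := leP 0 y; first by exists h, y.
  exists (weyl k * h)%g, (- y); split; last 1 first.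
  - by rewrite -mulgA; apply: (conj_intoM hy); apply: conj_into_weyl.
  - exact: (subgroupM (max_compact_subgroup hk) weyl_compact Kh).
  - by rewrite oppr_ge0 ltW.
have [h Kh /upper_triangular[b [a [a0 hgE]]]] := iwasawa g.
have KM := subgroupM (max_compact_subgroup hk).
have [n En] := val_finite hk a0.
have [hb|/(not_frac_ideal hk)[m Em m0]] := pselect ('P^0 b).
  exists (upper (- b) * h)%g, (x - 2 * n%:~R); split.
    by apply: KM => //; apply: upper_compact; apply: (frac_idealN hk).
  have -> : (upper (- b) * h * g = diag a0)%g; last exact: conj_into_diag.
  by rewrite -mulgA hgE; apply: SL2_eqP; rewrite !SL2_mulE !elementsE; split; field.
have Ea2 : val (a ^+ 2) = (n + n)%:E by rewrite expr2 (val_mul hk En En).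
have [hm|hm] := lerP (- x) (m - (n + n))%:~R.
  exists h, (x - 2 * n%:~R); split=> //; rewrite hgE upper_diag.
  apply: (@conj_intoM _ _ x x); last exact: conj_into_diag.
  apply: conj_into_upper hm.
  by rewrite (frac_ideal_ge _ (val_mul hk Em (val_inv hk Ea2))).
have b0 := val_neq0 hk Em.
(* Here [upper b] neither lies in K nor, moved past [diag a0], fixes x. In its Bruhat form the left
   lower factor lies in K, and the right one, moved past [diag a0], fixes x; what remains acts on
   the apartment by x -> x - 2n, a reflection, and a shift by -2m. *)
exists (lower (- b^-1) * h)%g, (- (x - 2 * n%:~R) - 2 * m%:~R); split.
  apply: KM => //; apply: lower_compact; apply: (frac_idealN hk).
  by rewrite (frac_ideal_ge _ (val_inv hk Em)); lia.
have -> : (lower (- b^-1) * h * g = diag b0 * (weyl k * (diag a0 * lower (b^-1 * a ^+ 2))))%g.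
  rewrite -lower_diag -mulgA hgE (upper_bruhat b0) -!mulgA.
  rewrite [X in (X = _)%g]mulgA -[RHS]mul1g; congr (_ * _)%g.
  by apply: SL2_eqP; rewrite !SL2_mulE !elementsE; split; ring.
apply: (@conj_intoM _ _ x (- (x - 2 * n%:~R))); last exact: conj_into_diag.
apply: (@conj_intoM _ _ x (x - 2 * n%:~R)); last exact: conj_into_weyl.
apply: (@conj_intoM _ _ x x); last exact: conj_into_diag.
apply: (@conj_into_lower _ (- m + (n + n))).
  by rewrite (frac_ideal_ge _ (val_mul hk (val_inv hk Em) Ea2)).
by move: hm; rewrite !intrD !intrN; lra.
Qed.

End Apartment.

(** * Representations and induction *)

Section Representations.
Variables (C : numFieldType) (G : groupType).
Variables (V : lmodType C) (rho : G -> {linear V -> V}).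
Hypothesis rho_rep : is_rep rho.
Implicit Types (H K N B : set G) (W : set V).

Lemma rep1 v : rho 1%g v = v. Proof. exact: rho_rep.1. Qed.

Lemma repM g h v : rho (g * h)%g v = rho g (rho h v).
Proof. exact: rho_rep.2. Qed.

Lemma repK g v : rho g^-1%g (rho g v) = v.
Proof. by rewrite -repM mulVg rep1. Qed.

Lemma repVK g v : rho g (rho g^-1%g v) = v.
Proof. by rewrite -repM mulgV rep1. Qed.

Lemma subrep0 H W : subrep H rho W -> W 0. Proof. by case. Qed.

Lemma subrepZ H W a v : subrep H rho W -> W v -> W (a *: v).
Proof. by move=> [W0 Wlin _] Wv; rewrite -[_ *: _]addr0; apply: Wlin. Qed.

Lemma subrepD H W v w : subrep H rho W -> W v -> W w -> W (v + w).
Proof. by move=> [W0 Wlin _] Wv Ww; rewrite -[v]scale1r; apply: Wlin. Qed.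

Lemma subrep_sum H W (I : eqType) (s : seq I) (F : I -> V) :
  subrep H rho W -> (forall i, i \in s -> W (F i)) -> W (\sum_(i <- s) F i).
Proof.
move=> HW; elim: s => [|i s IH] WF; first by rewrite big_nil; case: HW.
rewrite big_cons; apply: (subrepD HW); first by apply: WF; rewrite mem_head.
by apply: IH => j js; apply: WF; rewrite in_cons js orbT.
Qed.

Definition normal_in N K := forall x n, K x -> N n -> N (x^-1 * n * x)%g.

Definition fixed_by N W := forall n w, N n -> W w -> rho n w = w.

(** By normality the N-fixed vectors of [W] form a K-stable subspace, so irreducibility spreads a
    single one to all of [W]. *)
Lemma irreducible_fixed K N W : is_subgroup K -> normal_in N K ->
  irreducible_subrep K rho W -> has_fixed_vector N rho W -> fixed_by N W.
Proof.
move=> HK NK [WK _ Wirr] [v0 [Wv0 v0n0 fix0]].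
pose W' := [set v | W v /\ forall n, N n -> rho n v = v].
have subW' : subrep K rho W'.
  have [W0 Wlin Wst] := WK.
  split=> [|a v w [Wv fv] [Ww fw]|h v Kh [Wv fv]].
  - by split=> // n _; rewrite linear0.
  - by split=> [|n Nn]; [exact: Wlin|rewrite linearP fv ?fw].
  - split=> [|n Nn]; first exact: Wst.
    have := fv _ (NK _ _ Kh Nn); rewrite !repM => /(congr1 (rho h)).
    by rewrite repVK.
have [|W'0|<-] := Wirr W' subW'; first by move=> v [].
  by have : W' v0 by []; rewrite W'0 /= => /v0n0.
by move=> n w Nn [_]; apply.
Qed.

Lemma coset_reps_size H N (S : seq G) : coset_reps H N S ->
  (size S)%:R != 0 :> C.
Proof.
by move=> [_ [x xS _] _]; rewrite pnatr_eq0; case: (S) xS.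
Qed.

(** Maschke's averaging of x p x^-1 over K/N. The summand depends only on the coset of x when the
    argument is N-fixed, which is why equivariance is claimed for such vectors. *)
Lemma equivariant_projection K N S W : is_subgroup K -> is_subgroup N ->
  N `<=` K -> normal_in N K ->
  coset_reps K N S -> subrep K rho W -> fixed_by N W ->
  exists P : V -> V,
    [/\ (forall a v w, P (a *: v + w) = a *: P v + P w),
        (forall v, W (P v)), (forall w, W w -> P w = w) &
        forall h v, K h -> (forall n, N n -> rho n v = v) ->
          P (rho h v) = rho h (P v)].
Proof.
move=> HK HN sNK NK hS HW WN; have S0 := coset_reps_size hS.
have [SK _ Ssum] := hS.
have [p [plin pW pid]] : exists p : V -> V,
    [/\ (forall a v w, p (a *: v + w) = a *: p v + p w),
    (forall v, W (p v)) & (forall w, W w -> p w = w)].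
  by apply: subspace_projection; case: HW.
exists (fun v => (size S)%:R^-1 *: \sum_(x <- S) rho x (p (rho x^-1%g v))).
split=> [a v w|v|w Ww|h v Kh fixv].
- rewrite scalerA mulrC -scalerA -scalerDr; congr (_ *: _).
  rewrite scaler_sumr -big_split; apply: eq_bigr => x _ /=.
  by rewrite linearP plin linearP.
- apply: (subrepZ _ HW); apply: (subrep_sum HW) => x xS.
  by case: HW => _ _ Wst; apply: Wst; [exact: SK|exact: pW].
- rewrite (eq_big_seq (fun=> w)).
    by rewrite big_const_seq count_predT iter_addr_0 -scaler_nat scalerA mulVf ?scale1r.
  move=> x /SK Kx; rewrite pid ?repVK //; case: HW => _ _; apply=> //.
  exact: subgroupV.
- rewrite [RHS]linearZ [in RHS]linear_sum; congr (_ *: _).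
  rewrite -(Ssum _ (fun x => rho x (p (rho x^-1%g (rho h v)))) _ h Kh).
    by apply: eq_bigr => x _; rewrite repM invgM repM repK.
  move=> x n Kx Nn; rewrite repM (WN n) //.
  suff -> : rho (x * n)^-1%g (rho h v) = rho x^-1%g (rho h v) by [].
  rewrite invgM -!repM -mulgA repM.
  have Nn' : N (n^-1)%g by exact: subgroupV.
  have Kxh : K (x^-1 * h)%g by exact: HK.2.
  have := fixv _ (NK _ _ Kxh Nn'); rewrite 2!repM => /(congr1 (rho (x^-1 * h)%g)).
  by rewrite repVK -!repM.
Qed.

(** The coordinate [l] along [w] is averaged with weights [chi]. The value at [w] stays 1 because
    each term contributes chi(x) chi(x^-1). *)
Lemma equivariant_functional B N S (chi : G -> C) W w :
  is_subgroup B -> is_subgroup N -> coset_reps B N S ->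
  (forall g h, B g -> B h -> chi (g * h)%g = chi g * chi h) ->
  N `<=` B -> (forall n, N n -> chi n = 1) -> subrep B rho W -> fixed_by N W ->
  W w -> w <> 0 -> (forall b, B b -> rho b w = chi b *: w) ->
  exists lam : V -> C,
    [/\ (forall a v v', lam (a *: v + v') = a * lam v + lam v'),
        (forall b v, B b -> W v -> lam (rho b v) = chi b * lam v) & lam w = 1].
Proof.
move=> HB HN hS chiM sNB chi1 HW WN Ww w0 wchi; have S0 := coset_reps_size hS.
have [SB _ Ssum] := hS.
have [p [plin pW pid]] : exists p : V -> V,
    [/\ (forall a v w, p (a *: v + w) = a *: p v + p w),
    (forall v, (exists a, p v = a *: w)) &
    (forall v, (exists a, v = a *: w) -> p v = v)].
  apply: subspace_projection; first by exists 0; rewrite scale0r.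
  by move=> a _ _ [b ->] [c ->]; exists (a * b + c); rewrite scalerDl scalerA.
have [l hl] := choice pW.
have wI a b : a *: w = b *: w -> a = b.
  move=> /eqP; rewrite -subr_eq0 -scalerBl scaler_eq0 subr_eq0.
  by move=> /orP[/eqP //|/eqP].
have llin a v v' : l (a *: v + v') = a * l v + l v'.
  by apply: wI; rewrite -hl plin !hl scalerDl scalerA.
have lw a : l (a *: w) = a by apply: wI; rewrite -hl pid //; exists a.
have Bst b v : B b -> W v -> W (rho b v) by case: HW => _ _; apply.
exists (fun v => (size S)%:R^-1 * \sum_(x <- S) chi x * l (rho x^-1%g v)).
split=> [a v v'|b v Bb Wv|].
- rewrite mulrCA -mulrDr; congr (_ * _).
  rewrite mulr_sumr -big_split; apply: eq_bigr => x _ /=.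
  by rewrite linearP llin mulrDr mulrCA.
- rewrite mulrCA; congr (_ * _).
  have SbV := subgroupV HB Bb.
  rewrite -(Ssum C (fun x => chi x * l (rho x^-1%g v)) _ _ SbV); last first.
    move=> x n Bx Nn; rewrite chiM ?(chi1 n) ?mulr1 //; last exact: sNB.
    rewrite invgM repM (WN n^-1%g) //; first exact: subgroupV HN Nn.
    by apply: Bst => //; exact: subgroupV.
  rewrite mulr_sumr; apply: eq_big_seq => x /SB Bx.
  rewrite mulrA -chiM ?mulVKg //; last exact: subgroupM.
  by rewrite invgM invgK repM.
- rewrite (eq_big_seq (fun=> 1)).
    by rewrite big_const_seq count_predT iter_addr_0 mulVf.
  move=> x /SB Bx; have BVx := subgroupV HB Bx.
  by rewrite wchi // lw -chiM // mulgV chi1 //; apply: HN.1.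
Qed.

(* Frobenius reciprocity together with Mackey's irreducibility criterion. *)
Lemma irreducible_rep_iso_ind K B N (chi : G -> C) W w S SB :
  is_subgroup K -> is_subgroup B -> is_subgroup N ->
  N `<=` B -> B `<=` K -> normal_in N K ->
  coset_reps K N S -> coset_reps B N SB ->
  (forall g h, B g -> B h -> chi (g * h)%g = chi g * chi h) ->
  (forall n, N n -> chi n = 1) ->
  (forall x, K x -> ~ B x ->
    exists j, [/\ B j, B (x * j * x^-1)%g & chi (x * j * x^-1)%g <> chi j]) ->
  irreducible_subrep K rho W -> fixed_by N W ->
  W w -> w <> 0 -> (forall b, B b -> rho b w = chi b *: w) ->
  rep_iso K rho W (@right_regular C G) (ind_space B K chi).
Proof.
move=> HK HB HN sNB sBK NK hS hSB chiM chi1 intertw [WK _ Wirr] WN Ww w0 wchi.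
have [_ Wlin Wst] := WK.
have [lam [lamlin lamchi lamw]] : exists lam : V -> C,
    [/\ (forall a v v', lam (a *: v + v') = a * lam v + lam v'),
        (forall b v, B b -> W v -> lam (rho b v) = chi b * lam v) & lam w = 1].
  apply: (equivariant_functional HB HN hSB) => //.
  by split=> [|a v v'|h v /sBK]; [exact: subrep0 WK|exact: Wlin|exact: Wst].
have [SK [x0 x0S Nx0] Ssum] := hS.
(* The map that Frobenius reciprocity attaches to [lam], extended by 0 as [ind_space] requires. *)
pose T v : G -> C^o := fun x => if `[<K x>] then lam (rho x v) else 0.
have TK v x : K x -> T v x = lam (rho x v) by move=> Kx; rewrite /T asboolT.
have TnK v x : ~ K x -> T v x = 0 by move=> nKx; rewrite /T asboolF.
have KM g h : K g -> K h -> K (g * h)%g by exact: subgroupM.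
have lam0 : lam 0 = 0.
  have := lamlin 1 0 0; rewrite scale1r addr0 mul1r => /eqP.
  by rewrite -subr_eq0 opprD addNKr oppr_eq0 => /eqP.
have lamZ a v : lam (a *: v) = a * lam v by rewrite -[_ *: _]addr0 lamlin lam0 addr0.
have Tlin a v v' : T (a *: v + v') = a *: T v + T v'.
  apply/funext => x; have [Kx|nKx] := pselect (K x).
    by rewrite /GRing.add /GRing.scale /= !TK // linearP lamlin.
  by rewrite /GRing.add /GRing.scale /= !TnK // scaler0 addr0.
have Teq h v : K h -> T (rho h v) = right_translation h (T v).
  move=> Kh; apply/funext => x; rewrite /right_translation.
  have [Kx|nKx] := pselect (K x).
    by rewrite !TK ?repM //; exact: KM.
  rewrite !TnK // => Kxh; apply: nKx; rewrite -(mulgK h x).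
  exact: KM Kxh (subgroupV HK Kh).
have Tind v : W v -> ind_space B K chi (T v).
  move=> Wv; split=> [x /TnK//|j h Bj Kh].
  have Kjh := KM _ _ (sBK _ Bj) Kh.
  by rewrite !TK ?repM ?(lamchi j) //; exact: Wst.
have K1 : K 1%g := HK.1.
have Tw1 : T w 1%g = 1 by rewrite TK // rep1.
(* Evaluating [T w] at x j = (x j x^-1) x in both ways gives T w x chi(j) = chi(x j x^-1) T w x. *)
have Tw_supp x : K x -> ~ B x -> T w x = 0.
  move=> Kx nBx; have [j [Bj Bxj nchi]] := intertw x Kx nBx.
  have Kj := sBK _ Bj.
  have e1 : T w (x * j)%g = T w x * chi j.
    by rewrite !TK ?repM ?(wchi j) ?linearZ ?lamZ 1?mulrC //; exact: KM.
  have e2 : T w (x * j)%g = chi (x * j * x^-1)%g * T w x.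
    have -> : T w (x * j)%g = lam (rho (x * j * x^-1)%g (rho x w)).
      by rewrite TK -?repM ?mulgVK //; exact: KM.
    by rewrite (lamchi (x * j * x^-1)%g) ?TK //; exact: Wst.
  have /eqP := e1; rewrite e2 mulrC -subr_eq0 -mulrBr mulf_eq0 subr_eq0.
  by move=> /orP[/eqP|/eqP].
have WS x v : K x -> W v -> W (rho x v) by exact: Wst.
exists T; split=> //; last by move=> h v Kh _; exact: Teq.
split=> [v /Tind//|v v' /set_mem Wv /set_mem Wv' TE|f [fK find]].
  pose W' := [set v | W v /\ T v = 0].
  have subW' : subrep K rho W'.
    split=> [|a u u' [Wu u0] [Wu' u0']|h u Kh [Wu u0]].
    - split; first exact: subrep0 WK.
      by rewrite -[X in T X](addNr w) -scaleN1r Tlin scaleN1r addNr.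
    - by split; [exact: Wlin|rewrite Tlin u0 u0' scaler0 addr0].
    - by split; [exact: Wst|rewrite Teq // u0].
  have [|W'0|W'W] := Wirr W' subW'; first by move=> u [].
    have : W' (v - v').
      split; first by rewrite addrC -scaleN1r; apply: Wlin.
      by rewrite addrC -scaleN1r Tlin TE scaleN1r addNr.
    by rewrite W'0 /= => /eqP; rewrite subr_eq0 => /eqP.
  have : W' w by rewrite W'W.
  by move=> [_ /(congr1 (fun F => F 1%g))]; rewrite Tw1 => /eqP; rewrite oner_eq0.
pose nB := count (fun x => `[<B x>]) S.
have nB0 : nB%:R != 0 :> C.
  rewrite pnatr_eq0 -lt0n -has_count; apply/hasP.
  by exists x0 => //; apply/asboolP/sNB.
have lam_sum (s : seq G) (c : G -> C) (u : G -> V) :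
    lam (\sum_(i <- s) c i *: u i) = \sum_(i <- s) c i * lam (u i).
  elim: s => [|i s IH]; first by rewrite !big_nil lam0.
  by rewrite !big_cons lamlin IH.
(* Since [T w] equals [chi] on [B] and vanishes elsewhere on [K], [f] is a combination of its
   translates with coefficients f(x^-1). Each value is counted once per representative in [B], hence
   the factor 1/nB. *)
exists (nB%:R^-1 *: \sum_(x <- S) f x^-1%g *: rho x w).
  apply: (subrepZ _ WK); apply: (subrep_sum WK) => x /SK Kx.
  by apply: (subrepZ _ WK); apply: WS.
apply/funext => y; have [Ky|nKy] := pselect (K y); last by rewrite TnK // fK.
have KVy := subgroupV HK Ky.
rewrite TK // linearZ linear_sum lamZ.
under eq_bigr do rewrite linearZ.
rewrite lam_sum.
have -> : \sum_(x <- S) f x^-1%g * lam (rho y (rho x w)) =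
    \sum_(x <- S) (f x^-1%g : C) * T w (y * x)%g.
  by apply: eq_big_seq => x /SK Kx; rewrite TK ?repM //; exact: KM.
rewrite -(Ssum _ (fun x => (f x^-1%g : C) * T w (y * x)%g) _ _ KVy); last first.
  move=> x n Kx Nn; have KVx := subgroupV HK Kx; have NVn := subgroupV HN Nn.
  have Kyx := KM _ _ Ky Kx; have Kn := sBK _ (sNB _ Nn).
  rewrite invgM (find (n^-1)%g) ?chi1 ?mul1r //; last exact: sNB.
  by rewrite mulgA !TK ?(repM _ n) ?(WN n) //; exact: KM.
rewrite (eq_big_seq (fun x => if `[<B x>] then f y else 0)); last first.
  move=> x /SK Kx; rewrite invgM invgK mulVKg; case: asboolP => [Bx|nBx].
    have BVx := subgroupV HB Bx.
    rewrite (find (x^-1)%g) // TK // wchi // lamZ lamw mulr1 mulrAC -chiM //.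
    by rewrite mulVg chi1 ?mul1r //; exact: HN.1.
  by rewrite Tw_supp ?mulr0.
rewrite -big_mkcond big_const_seq iter_addr_0 -[f y *+ _]mulr_natr.
by rewrite mulrCA mulVf ?mulr1.
Qed.

End Representations.

(** * Fixed vectors in irreducible components *)

Section FixedVectors.
Variables (R : realType) (k : fieldType) (val : k -> \bar int) (p : nat).
Hypothesis hk : is_padic_field val p.
Local Notation "''P^' n" := (frac_ideal val n) (at level 2).
Local Notation K := (max_compact val).
Local Notation G := (SL2 k).
Local Notation C := R[i].
Local Notation Kn n := (box val n n n).
Variables (V : lmodType C) (pi : G -> {linear V -> V}).
Hypothesis pi_rep : is_rep pi.
Hypothesis pi_smooth : smooth val pi.

Lemma translates_span (v0 : V) : irreducible_subrep setT pi setT -> v0 <> 0 ->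
  forall v, exists s : seq (C * G), v = \sum_(a <- s) a.1 *: pi a.2 v0.
Proof.
move=> [_ _ irr] v0n0.
pose W := [set v | exists s : seq (C * G), v = \sum_(a <- s) a.1 *: pi a.2 v0].
have subW : subrep setT pi W.
  split=> [|a _ _ [s ->] [s' ->]|g _ _ [s ->]].
  - by exists [::]; rewrite big_nil.
  - exists ([seq (a * b.1, b.2) | b <- s] ++ s'); rewrite big_cat big_map /=.
    by congr (_ + _); rewrite scaler_sumr; apply: eq_bigr => b _; rewrite scalerA.
  - exists [seq (b.1, (g * b.2)%g) | b <- s]; rewrite big_map linear_sum.
    by apply: eq_bigr => b _ /=; rewrite linearZ (repM pi_rep).
have [//|W0|WT] := irr W subW.
  have : W v0 by exists [:: (1, 1%g)]; rewrite big_seq1 scale1r (rep1 pi_rep).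
  by rewrite W0.
by move=> v; have : W v by rewrite WT.
Qed.

Lemma smooth_box v : exists n : nat, forall m : nat, (n <= m)%N ->
  forall g, Kn m%:Z g -> pi g v = v.
Proof.
have [n hn] := pi_smooth v; exists (absz n) => m nm g hg; apply: hn.
have [g1 g2 g3 g4] : Kn n g by apply: (box_sub _ _ _ hg); lia.
by move=> i j; case: (ord2P i) (ord2P j) => -> [] ->; rewrite !mxE /= ?mulr1n ?mulr0n ?subr0.
Qed.

Lemma Kn_subgroup (n : nat) : is_subgroup (Kn n%:Z).
Proof. by apply: (box_subgroup hk); rewrite ?lerDl. Qed.

Lemma Kn_compact (n : nat) : Kn n%:Z `<=` K.
Proof. exact: (box_max_compact hk). Qed.

Lemma Kn_coset_reps (H : set G) (n : nat) : is_subgroup H -> Kn n%:Z `<=` H ->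
  H `<=` K -> exists S, coset_reps H (Kn n%:Z) S.
Proof.
move=> HH nH HK; apply: (compact_coset_reps hk (n := n)) => //.
exact: Kn_subgroup.
Qed.

(** A nonzero vector of [W] is a combination of translates of [v0] and is its own projection, so
    some translate has nonzero projection; K-equivariance lets that projection inherit the fixing
    group. *)
Lemma apartment_fixed_vector (W : set V) (D : nat) (v0 : V) (x r : R) :
  irreducible_subrep setT pi setT -> irreducible_subrep K pi W ->
  fixed_by pi (Kn D%:Z) W ->
  v0 <> 0 -> (forall g, Gxr_plus val x r g -> pi g v0 = v0) ->
  exists2 y : R, 0 <= y &
    has_fixed_vector (K `&` Gxr_plus val y r) pi W.
Proof.
move=> irrT [WK [w0 Ww0 w0n0] _] WD v0n0 v0fix.
have [s w0E] := translates_span irrT v0n0 w0.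
(* One level [M] at which the finitely many translates and all of [W] are fixed, so that the
   projection is equivariant on those translates. *)
have [M [MD hM]] : exists M : nat, (D <= M)%N /\ forall a, a \in s ->
    forall g, Kn M%:Z g -> pi g (pi a.2 v0) = pi a.2 v0.
  elim: s {w0E} => [|a s [M [MD hM]]]; first by exists D.
  have [n hn] := smooth_box (pi a.2 v0).
  exists (maxn n M); split; first by rewrite leq_max MD orbT.
  move=> b; rewrite in_cons => /orP[/eqP->|bs] g hg.
    by apply: hn hg; rewrite leq_maxl.
  by apply: hM bs _ _; apply: (box_sub _ _ _ hg); rewrite lez_nat leq_maxr.
have HK := max_compact_subgroup hk.
have NK : normal_in (Kn M%:Z) K by move=> g h; apply: (Kn_normal hk).
have WM : fixed_by pi (Kn M%:Z) W.
  by move=> g w hg; apply: WD; apply: (box_sub _ _ _ hg); rewrite lez_nat.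
have [S hS] := Kn_coset_reps HK (@Kn_compact M) (@subset_refl _ _).
have [P [Plin PW Pid PK]] := equivariant_projection pi_rep HK (Kn_subgroup M)
  (@Kn_compact M) NK hS WK WM.
have P0 : P 0 = 0.
  have := Plin 1 0 0; rewrite !scale1r addr0 => /eqP.
  by rewrite -subr_eq0 opprD addNKr oppr_eq0 => /eqP.
have [a as_ Pa] : exists2 a, a \in s & P (pi a.2 v0) <> 0.
  apply: contrapT => nP; apply: w0n0; rewrite -(Pid _ Ww0) w0E.
  have {}nP a : a \in s -> P (pi a.2 v0) = 0.
    by move=> sa; apply: contrapT => Pa; apply: nP; exists a.
  elim: (s) nP => [|b t IH] nP; first by rewrite big_nil P0.
  rewrite big_cons Plin nP ?mem_head // scaler0 add0r IH // => c ct.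
  by apply: nP; rewrite in_cons ct orbT.
have [h [y [Kh y0 hy]]] := conj_into_apartment hk r a.2 x.
exists y => //; exists (P (pi h (pi a.2 v0))).
have fixa g : Kn M%:Z g -> pi g (pi a.2 v0) = pi a.2 v0 by exact: hM.
split=> // [|g [Kg gy]].
  by rewrite PK // => /(congr1 (pi h^-1%g)); rewrite (repK pi_rep) linear0.
rewrite -PK //; last first.
  move=> n Nn; have := fixa _ (NK _ _ Kh Nn); rewrite !(repM pi_rep).
  by move=> /(congr1 (pi h)); rewrite (repVK pi_rep).
congr P; have := v0fix _ (hy _ gy); rewrite !(repM pi_rep).
move=> /(congr1 (pi (h * a.2)%g)); rewrite (repVK pi_rep) !(repM pi_rep).
by [].
Qed.

(** G_{0,t+} depends only on floor(t), so the minimum is attained at an integer. *)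
Lemma depth_K_integer (W : set V) (s : R) :
  irreducible_subrep K pi W -> is_depth_K val pi W s -> 0 < s ->
  exists d : nat, [/\ (0 < d)%N, s = d%:R, fixed_by pi (Kn d.+1%:Z) W &
    forall w, W w -> (forall g, Kn d%:Z g -> pi g w = w) -> w = 0].
Proof.
move=> irrW [[s0 fixs] smin] spos.
have GK (t : R) g : Gxr_plus val 0 t g <-> Kn (Num.floor t + 1) g.
  by rewrite /Gxr_plus /filtration /= subr0 addr0.
have [d Ed] : exists d : nat, Num.floor s = d%:Z.
  exists (absz (Num.floor s)); rewrite gez0_abs //.
  by rewrite floor_ge_int.
have sE : s = d%:R.
  apply/eqP; rewrite eq_le; apply/andP; split; last first.
    by have := floor_le s; rewrite Ed.
  apply: smin; split; first exact: ler0n.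
  have [v [Wv v0 fv]] := fixs; exists v; split=> // g; rewrite GK => hg.
  by apply: fv; rewrite GK Ed; move: hg; rewrite -[d%:R]/(d%:Z%:~R) intrKfloor.
have d0 : (0 < d)%N by move: spos; rewrite sE ltr0n.
exists d; split=> //.
  apply: (irreducible_fixed pi_rep (max_compact_subgroup hk) _ irrW).
    by move=> g h; apply: (Kn_normal hk).
  have [v [Wv v0 fv]] := fixs; exists v; split=> // g hg; apply: fv.
  by rewrite GK Ed; apply: (box_sub _ _ _ hg); lia.
move=> w Ww fw; apply: contrapT => w0.
(* G_{0,d} is G_{0,(d-1)+}, so a nonzero vector fixed by it would lower the depth to d - 1. *)
have : s <= (d.-1)%:R.
  apply: smin; split; first exact: ler0n.
  exists w; split=> // g; rewrite GK => hg; apply: fw.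
  move: hg; rewrite -[(d.-1)%:R]/(d.-1%:Z%:~R) intrKfloor => hg.
  by apply: (box_sub _ _ _ hg); lia.
by rewrite sE ler_nat; lia.
Qed.

Lemma iwahori_fixed_vector (W : set V) (d : nat) (r y : R) :
  (0 < d)%N -> 0 <= r -> 2 * r < d%:R -> 0 <= y ->
  fixed_by pi (Kn d.+1%:Z) W ->
  (forall w, W w -> (forall g, Kn d%:Z g -> pi g w = w) -> w = 0) ->
  has_fixed_vector (K `&` Gxr_plus val y r) pi W ->
  has_fixed_vector (box val (d - d./2)%N%:Z 0 d.+1%:Z) pi W.
Proof.
move=> d0 r0 rd y0 Wd1 Wd [w [Ww w0 fw]].
have Enat (n : nat) : n%:R = n%:Z%:~R :> R by [].
have hd2 : d = (d./2 + d./2 + odd d)%N by lia.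
have frc : floor_succ r <= (d - d./2)%N%:Z.
  rewrite /floor_succ -ltzD1 ltrD2r floor_lt_int -Enat.
  have : (d%:R : R) <= 2 * (d - d./2)%N%:R by rewrite -natrM ler_nat; lia.
  lra.
(* If r + y < d, then every exponent of G_{y,r+} is at most d, so G_{0,d} would fix [w]. *)
have Dy : d%:R <= r + y.
  rewrite leNgt; apply/negP => ryd; apply: w0; apply: Wd => // g hg; apply: fw.
  split; first exact: (Kn_compact hg).
  apply/Gxr_plusP; apply: (box_sub _ _ _ hg).
  - by apply: le_trans frc _; lia.
  - by rewrite /floor_succ -ltzD1 ltrD2r floor_lt_int -Enat; lra.
  - by rewrite /floor_succ -ltzD1 ltrD2r floor_lt_int -Enat; lra.
exists w; split=> // g hg.
have c0 : 0 <= (d - d./2)%N%:Z :> int by [].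
have [g1 g2 g3 g4] := hg.
have c1 : 0 < (d - d./2)%N%:Z :> int by lia.
have E11 : val (g 1 1) = 0%:E := val_cong1 hk c1 g4.
have g11n0 := val_neq0 hk E11.
have detU : (g 1 1)^-1 * g 1 1 - g 0 1 * 0 = 1 by rewrite mulr0 subr0 mulVf.
(* The lower factor lies in G_{0,d+}, trivial on [W]; the upper triangular one has lower left entry
   0 and so meets the condition of G_{y,r+} there however large y is. *)
have gE : g = (SL2_of detU * lower (g 1 0 / g 1 1)%R)%g.
  have E : g 0 0 * g 1 1 = 1 + g 0 1 * g 1 0 by rewrite -(SL2_detE g) subrK.
  apply: SL2_eqP; rewrite !SL2_mulE !SL2_ofE ?elementsE; split.
  - by apply: (mulIf g11n0); rewrite E; field.
  - by ring.
  - by field.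
  - by ring.
have i11 : 'P^0 (g 1 1)^-1 by rewrite (frac_ideal_ge _ (val_inv hk E11)) oppr0.
have i11' : 'P^(d - d./2)%N%:Z ((g 1 1)^-1 - 1).
  have -> : (g 1 1)^-1 - 1 = - ((g 1 1)^-1 * (g 1 1 - 1)) by field.
  by ideal.
rewrite gE (repM pi_rep) (Wd1 (lower _)) //.
  apply: fw; split.
    apply: (@box_max_compact _ _ _ hk (d - d./2)%N%:Z 0 0) => //.
    by apply/boxP; rewrite !SL2_ofE; split=> //; ideal.
  apply/Gxr_plusP; apply: (@box_sub _ _ (d - d./2)%N%:Z 0 (floor_succ (r + y))) => //.
    by rewrite /floor_succ -ltzD1 ltrD2r floor_lt_int; lra.
  by apply/boxP; rewrite !SL2_ofE; split=> //; ideal.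
by apply/boxP; rewrite !elementsE subrr; split; ideal.
Qed.

End FixedVectors.

(** * Eigenvectors of the lower unipotents *)

Section AdditiveCharacter.
Variables (R : realType) (k : fieldType) (val : k -> \bar int) (p : nat).
Hypothesis hk : is_padic_field val p.
Local Notation "''P^' n" := (frac_ideal val n) (at level 2).
Local Notation K := (max_compact val).
Local Notation G := (SL2 k).
Local Notation C := R[i].
Local Notation Kn n := (box val n n n).
Variables (varpi : k) (Psi : k -> C).
Hypothesis val_varpi : val varpi = 1%:E.
Hypothesis PsiD : forall x y, Psi (x + y) = Psi x * Psi y.
Hypothesis Psi_P : forall x, 'P^1 x -> Psi x = 1.
Hypothesis Psi_R : exists2 x, 'P^0 x & Psi x <> 1.

Lemma Psi0 : Psi 0 = 1. Proof. by apply: Psi_P; ideal. Qed.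

Lemma PsiN x : Psi x * Psi (- x) = 1.
Proof. by rewrite -PsiD subrr Psi0. Qed.

Lemma Psi_cong x y : 'P^1 (x - y) -> Psi x = Psi y.
Proof. by move=> h; rewrite -(subrK y x) PsiD Psi_P ?mul1r. Qed.

(** As [Psi] is trivial on P but not on R, the annihilator of P^n is P^(1-n). Triviality of a
    character thus becomes a congruence. *)
Lemma Psi_trivial (n : int) z :
  (forall x, 'P^n x -> Psi (z * x) = 1) -> 'P^(1 - n) z.
Proof.
move=> h; apply: contrapT => /(not_frac_ideal hk)[m Em mn].
have [x0 hx0 nx0] := Psi_R; apply: nx0; have z0 := val_neq0 hk Em.
have -> : x0 = z * (z^-1 * x0) by rewrite mulVKf.
apply: h; rewrite (frac_ideal_divl hk _ _ (val_inv hk Em)).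
by apply: frac_idealW hx0; lia.
Qed.

Lemma scaled_ideal (n d : int) t : 'P^n t <-> 'P^(n - d) (varpi ^ (- d) * t).
Proof.
rewrite (frac_ideal_divl hk _ _ (val_expz hk (- d) val_varpi)).
by have -> : n - d - - d = n by lia.
Qed.

Variables (V : lmodType C) (pi : G -> {linear V -> V}).
Hypothesis pi_rep : is_rep pi.
Variable d : nat.
Hypothesis d_gt0 : (0 < d)%N.
Local Notation c := (d - d./2)%N.
Local Notation m := (d./2.+1)%N.

(** This is [Psi_X] for [antidiag u 0] with its trace evaluated, as [Psi_XE] records. *)
Definition psi_u (u : k) (g : G) : C := Psi (varpi ^ (- d%:Z) * (u * g 1 0)).

Lemma lower_mul (a b : k) : (lower a * lower b)%g = lower (a + b).
Proof. by apply: SL2_eqP; rewrite !SL2_mulE !elementsE; split; ring. Qed.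

Lemma lower_inv (a : k) : ((lower a)^-1)%g = lower (- a).
Proof. by apply: SL2_eqP; rewrite !SL2_invE !elementsE oppr0. Qed.

Lemma upper_mul (a b : k) : (upper a * upper b)%g = upper (a + b).
Proof. by apply: SL2_eqP; rewrite !SL2_mulE !elementsE; split; ring. Qed.

Lemma upper_inv (a : k) : ((upper a)^-1)%g = upper (- a).
Proof. by apply: SL2_eqP; rewrite !SL2_invE !elementsE oppr0. Qed.

Lemma lower_subgroup n : is_subgroup [set lower y | y in 'P^n].
Proof.
split; first by exists 0; [ideal|apply: SL2_eqP; rewrite !elementsE].
move=> _ _ [a ha <-] [b hb <-]; exists (- a + b); first by rewrite addrC; ideal.
by rewrite lower_inv lower_mul.
Qed.

Lemma upper_subgroup n : is_subgroup [set upper y | y in 'P^n].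
Proof.
split; first by exists 0; [ideal|apply: SL2_eqP; rewrite !elementsE].
move=> _ _ [a ha <-] [b hb <-]; exists (- a + b); first by rewrite addrC; ideal.
by rewrite upper_inv upper_mul.
Qed.

Lemma lower_reps : exists S,
  coset_reps [set lower y | y in 'P^m%:Z] [set lower y | y in 'P^d.+1%:Z] S.
Proof.
apply: (compact_coset_reps hk (n := d.+1)).
- exact: lower_subgroup.
- exact: lower_subgroup.
- by move=> _ [y hy <-]; exists y => //; apply: frac_idealW hy; lia.
- by move=> _ [y hy <-]; apply: (lower_compact hk); apply: frac_idealW hy; lia.
- by move=> _ [y hy <-] [_ _ + _]; rewrite elementsE => h; exists y.
Qed.

(** These unipotents serve as labels for frequencies: under Psi(varpi^-d t y), R/P^c is the dual of
    P^m/P^(d+1). *)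
Lemma upper_reps : exists S,
  coset_reps [set upper y | y in 'P^0] [set upper y | y in 'P^c%:Z] S.
Proof.
apply: (compact_coset_reps hk (n := c)).
- exact: upper_subgroup.
- exact: upper_subgroup.
- by move=> _ [y hy <-]; exists y => //; apply: frac_idealW hy; lia.
- by move=> _ [y hy <-]; apply: (upper_compact hk).
- by move=> _ [y hy <-] [_ + _ _]; rewrite elementsE => h; exists y.
Qed.

Lemma iwahori_factor (n : nat) g : (m <= n)%N -> box val c%:Z 0 n%:Z g ->
  exists y b, [/\ 'P^n%:Z y, box val c%:Z 0 d.+1%:Z b, g = (lower y * b)%g &
    'P^(n + c)%:Z (y - g 1 0)].
Proof.
move=> mn [g1 g2 g3 g4].
have c0 : 0 < c%:Z :> int by lia.
have E0 := val_cong1 hk c0 g1; have g0 := val_neq0 hk E0.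
have E : g 0 0 * g 1 1 = 1 + g 0 1 * g 1 0 by rewrite -(SL2_detE g) subrK.
have E' : g 0 0 * (g 0 0)^-1 - g 0 1 * 0 = 1 by rewrite mulr0 subr0 mulfV.
have iP : 'P^0 (g 0 0)^-1 by rewrite (frac_ideal_ge _ (val_inv hk E0)) oppr0.
exists (g 1 0 / g 0 0), (SL2_of E'); split.
- by ideal.
- apply/boxP; rewrite !SL2_ofE; split=> //; first by ideal.
  have -> : (g 0 0)^-1 - 1 = - ((g 0 0)^-1 * (g 0 0 - 1)) by field.
  by ideal.
- apply: SL2_eqP; rewrite !SL2_mulE !SL2_ofE; split; try by field.
  by apply: (mulfI g0); rewrite E; field.
- have -> : g 1 0 / g 0 0 - g 1 0 = - (g 1 0 * (g 0 0)^-1 * (g 0 0 - 1)) by field.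
  by rewrite PoszD; ideal.
Qed.

Lemma lower_eigenvector (W : set V) :
  subrep K pi W ->
  has_fixed_vector (box val c%:Z 0 d.+1%:Z) pi W ->
  exists u w, [/\ 'P^0 u, W w, w <> 0 &
    forall g, box val c%:Z 0 m%:Z g -> pi g w = psi_u u g *: w].
Proof.
move=> WK [w [Ww w0 fw]].
have [Lp [LS [l0 l0S Nl0] Lsum]] := lower_reps.
have [Up [US [t0 t0U _] Usum]] := upper_reps.
pose e u y := Psi (varpi ^ (- d%:Z) * (u * y)).
have eDl u u' y : e (u + u') y = e u y * e u' y by rewrite /e -PsiD -mulrDr -mulrDl.
have eDr u y y' : e u (y + y') = e u y * e u y' by rewrite /e -PsiD -!mulrDr.
have e1 u y : 'P^d.+1%:Z (u * y) -> e u y = 1.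
  by move=> /(scaled_ideal _ d%:Z) h; apply: Psi_P; apply: frac_idealW h; lia.
(* The Fourier coefficient at u of y -> pi(lower y) w, with y in P^m modulo P^(d+1). *)
pose f u := \sum_(x <- Lp) e u (- (x : G) 1 0) *: pi x w.
have Wf u : W (f u).
  apply: (subrep_sum WK) => x /LS [y hy <-]; apply: (subrepZ _ WK).
  case: WK => _ _; apply=> //; apply: (lower_compact hk).
  by apply: frac_idealW hy; lia.
(* Fourier inversion: the sum of the coefficients over all frequencies is a positive multiple of
   [w], so they cannot all vanish. *)
have [t tU ft] : exists2 t, t \in Up & f ((t : G) 0 1) <> 0.
  apply: contrapT => nf.
  have : \sum_(t <- Up) f ((t : G) 0 1) = 0.
    by apply: big1_seq => t /andP[_ tU]; apply: contrapT => ft; apply: nf; exists t.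
  rewrite exchange_big /=.
  pose NL := [set lower y | y in 'P^d.+1%:Z].
  have -> : \sum_(x <- Lp) \sum_(t <- Up) e ((t : G) 0 1) (- (x : G) 1 0) *: pi x w
    = \sum_(x <- Lp) (if `[<NL x>] then (size Up)%:R *: w else 0).
    apply: eq_big_seq => x /LS [y hy <-]; rewrite -scaler_suml elementsE.
    case: asboolP => [[y' hy' /(congr1 (fun g : G => g 1 0))]|nN].
      rewrite !elementsE => Ey; rewrite fw; last first.
        by apply/boxP; rewrite !elementsE subrr -Ey; split; ideal.
      congr (_ *: _); rewrite (eq_big_seq (fun=> 1)).
        by rewrite big_const_seq count_predT iter_addr_0.
      by move=> t /US [b hb <-]; rewrite elementsE -Ey; apply: e1; ideal.
    (* A nontrivial character sums to 0: translating the frequencies by a suitable b multiplies the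
       sum by a value other than 1. *)
    set Sg := \sum_(t <- Up) _; suff -> : Sg = 0 by rewrite scale0r.
    have [b hb nb] : exists2 b, 'P^0 b & e b (- y) <> 1.
      apply: contrapT => nb; apply: nN; exists y => //.
      apply/(scaled_ideal _ d%:Z).
      apply: (@frac_idealW _ _ _ (1 - 0)); first by lia.
      rewrite -[y]opprK mulrN; apply: (frac_idealN hk); apply: Psi_trivial => z hz.
      apply: contrapT => h; apply: nb; exists z => //.
      by rewrite /e [z * _]mulrC mulrA.
    have Ub : [set upper y | y in 'P^0] (upper b) by exists b.
    have := Usum C (fun t => e ((t : G) 0 1) (- y)) _ _ Ub.
    rewrite (eq_big_seq (fun t => e b (- y) * e ((t : G) 0 1) (- y))); last first.
      move=> t' /US[b' _ <-]; rewrite -eDl SL2_mulE !elementsE.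
      by rewrite mul1r mulr1 addrC.
    rewrite -mulr_sumr => /(_ _)/eqP h; apply/eqP.
    have : e b (- y) * Sg == Sg.
      apply: h => _ _ [b1 hb1 <-] [b2 hb2 <-].
      rewrite upper_mul !elementsE eDl [X in _ * X]e1 ?mulr1 //.
      by ideal.
    rewrite -subr_eq0 -[X in _ - X]mul1r -mulrBl mulf_eq0 subr_eq0.
    by move=> /orP[/eqP //|].
  rewrite -big_mkcond big_const_seq iter_addr_0 -scaler_nat scalerA => /eqP.
  rewrite scaler_eq0 mulf_eq0 !pnatr_eq0 -leqn0 leqNgt -has_count size_eq0.
  case/orP => [/orP[/hasPn/(_ _ l0S)/asboolP //|/eqP U0]|/eqP //].
  by rewrite U0 in t0U.
have [t' ht' tE] := US _ tU.
exists (t' : k), (f t'); split=> //; first by move: ft; rewrite -tE elementsE.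
have low y : 'P^m%:Z y -> pi (lower y) (f t') = e t' y *: f t'.
  move=> hy; have Ly : [set lower y | y in 'P^m%:Z] (lower y) by exists y.
  rewrite [in LHS]/f linear_sum.
  rewrite -[f t'](Lsum V (fun x => e t' (- (x : G) 1 0) *: pi x w) _ _ Ly); last first.
    move=> _ _ [y1 hy1 <-] [y2 hy2 <-].
    rewrite (repM pi_rep) (fw (lower y2)); last first.
      by apply/boxP; rewrite !elementsE subrr; split; ideal.
    rewrite lower_mul !elementsE opprD eDr [X in _ * X]e1 ?mulr1 //.
    by ideal.
  rewrite scaler_sumr; apply: eq_big_seq => x /LS [y1 hy1 <-].
  rewrite linearZ scalerA lower_mul -eDr !elementsE opprD addNKr.
  by rewrite -(repM pi_rep) lower_mul.
(* Conjugation by [lower y] with y in P^m preserves this box, because m >= c, m + c = d + 1 and 2m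
   >= d + 1. *)
have up b : box val c%:Z 0 d.+1%:Z b -> pi b (f t') = f t'.
  move=> hb; rewrite [in LHS]/f linear_sum; apply: eq_big_seq => x /LS [y hy <-].
  rewrite linearZ; congr (_ *: _); apply: (can_inj (repK pi_rep (lower y)^-1%g)).
  rewrite -!(repM pi_rep) mulVg (rep1 pi_rep); apply: fw.
  have [b1 b2 b3 b4] := hb; rewrite lower_inv; apply/boxP.
  rewrite !SL2_mulE !elementsE; split.
  - have -> : (1 * b 0 0 + 0 * b 1 0) * 1 + (1 * b 0 1 + 0 * b 1 1) * y - 1 =
      (b 0 0 - 1) + b 0 1 * y by ring.
    by ideal.
  - have -> : (1 * b 0 0 + 0 * b 1 0) * 0 + (1 * b 0 1 + 0 * b 1 1) * 1 = b 0 1 by ring.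
    by [].
  - have -> : (- y * b 0 0 + 1 * b 1 0) * 1 + (- y * b 0 1 + 1 * b 1 1) * y =
      b 1 0 + y * (b 1 1 - 1) - y * (b 0 0 - 1) - y * y * b 0 1 by ring.
    by ideal.
  - have -> : (- y * b 0 0 + 1 * b 1 0) * 0 + (- y * b 0 1 + 1 * b 1 1) * 1 - 1 =
      (b 1 1 - 1) - y * b 0 1 by ring.
    by ideal.
move=> g hg; have [y [b [hy hb -> yg]]] := iwahori_factor (leqnn _) hg.
rewrite (repM pi_rep) up // low //; congr (_ *: _).
(* The parameter of the lower factor and the lower left entry of the product differ by P^(m+c) =
   P^(d+1), which the character does not see. *)
apply: Psi_cong; rewrite -!mulrBr.
have /(scaled_ideal _ d%:Z) h : 'P^(m + c)%:Z (t' * (y - (lower y * b)%g 1 0)).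
  by ideal.
by apply: frac_idealW h; lia.
Qed.

Lemma eigenvector_unit (W : set V) u w :
  (forall w', W w' -> (forall g, Kn d%:Z g -> pi g w' = w') -> w' = 0) ->
  W w -> w <> 0 -> (forall g, box val c%:Z 0 m%:Z g -> pi g w = psi_u u g *: w) ->
  ~ 'P^1 u.
Proof.
move=> Wd Ww w0 wpsi hu; apply: w0; apply: Wd => // g hg.
rewrite wpsi; last by apply: (box_sub _ _ _ hg); lia.
rewrite /psi_u Psi_P ?scale1r //; have [_ _ g3 _] := hg.
have /(scaled_ideal _ d%:Z) h : 'P^(1 + d%:Z) (u * g 1 0) by ideal.
by apply: frac_idealW h; lia.
Qed.

Lemma eigenvector_diag w u a (a0 : a != 0) : val a = 0%:E ->
  (forall g, box val c%:Z 0 m%:Z g -> pi g w = psi_u u g *: w) ->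
  forall g, box val c%:Z 0 m%:Z g ->
    pi g (pi (diag a0) w) = psi_u (u * a ^+ 2) g *: pi (diag a0) w.
Proof.
move=> Ea wpsi g [g1 g2 g3 g4].
have Pa : 'P^0 a by rewrite (frac_ideal_ge _ Ea).
have Pia : 'P^0 a^-1 by rewrite (frac_ideal_ge _ (val_inv hk Ea)) oppr0.
have E10 : ((diag a0)^-1 * g * diag a0)%g 1 0 = a ^+ 2 * g 1 0.
  by rewrite !SL2_mulE !SL2_invE !elementsE; ring.
have hj : box val c%:Z 0 m%:Z ((diag a0)^-1 * g * diag a0)%g.
  apply/boxP; rewrite E10; split; last 1 first.
  - rewrite !SL2_mulE !SL2_invE !elementsE.
    have -> : (- 0 * g 0 0 + a * g 1 0) * 0 + (- 0 * g 0 1 + a * g 1 1) * a^-1 - 1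
      = g 1 1 - 1 by field.
    by [].
  - rewrite !SL2_mulE !SL2_invE !elementsE.
    have -> : (a^-1 * g 0 0 + - 0 * g 1 0) * a + (a^-1 * g 0 1 + - 0 * g 1 1) * 0 - 1
      = g 0 0 - 1 by field.
    by [].
  - rewrite !SL2_mulE !SL2_invE !elementsE.
    have -> : (a^-1 * g 0 0 + - 0 * g 1 0) * 0 + (a^-1 * g 0 1 + - 0 * g 1 1) * a^-1
      = a^-1 * a^-1 * g 0 1 by ring.
    by ideal.
  - by ideal.
have := wpsi _ hj; rewrite /psi_u E10 !(repM pi_rep) => /(congr1 (pi (diag a0))).
by rewrite (repVK pi_rep) linearZ mulrA.
Qed.

End AdditiveCharacter.

Lemma prod_char_eq (C : fieldType) (G : groupType) (A : set G) (phi : G -> C)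
    (B : set G) (psi : G -> C) (x : G) (z : C) :
  prod_set A B x ->
  (forall a b, A a -> B b -> x = (a * b)%g -> phi a * psi b = z) ->
  prod_char A phi B psi x = z.
Proof.
move=> [a Aa [b Bb xE]] h; rewrite /prod_char; case: xgetP => [w -> |/(_ (phi a * psi b))].
  by move=> [a' [b' [Aa' Bb' xE' ->]]]; apply: h.
by case; exists a, b; split.
Qed.

(** * The inducing character *)

Section ShalikaCharacter.
Variables (R : realType) (k : fieldType) (val : k -> \bar int) (p : nat).
Hypothesis hk : is_padic_field val p.
Hypothesis val_two : val 2%:R = 0%:E.
Local Notation "''P^' n" := (frac_ideal val n) (at level 2).
Local Notation K := (max_compact val).
Local Notation G := (SL2 k).
Local Notation C := R[i].
Local Notation Kn n := (box val n n n).
Variables (varpi : k) (Psi : k -> C).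
Hypothesis val_varpi : val varpi = 1%:E.
Hypothesis PsiD : forall x y, Psi (x + y) = Psi x * Psi y.
Hypothesis Psi_P : forall x, 'P^1 x -> Psi x = 1.
Hypothesis Psi_R : exists2 x, 'P^0 x & Psi x <> 1.
Variable d : nat.
Hypothesis d_gt0 : (0 < d)%N.
Local Notation c := (d - d./2)%N.
Local Notation m := (d./2.+1)%N.
Local Notation J := (box val c%:Z 0 m%:Z).

Fact negone_subproof : (-1) * (-1) - 0 * 0 = 1 :> k. Proof. by ring. Qed.
Definition negone : G := SL2_of negone_subproof.

Lemma negoneE (g : G) i j : (negone * g)%g i j = - g i j.
Proof.
by case: (ord2P i) => ->; rewrite SL2_mulE !SL2_ofE; ring.
Qed.

Lemma negoneC g : (negone * g = g * negone)%g.
Proof. by apply: SL2_eqP; rewrite !negoneE !SL2_mulE !SL2_ofE; split; ring. Qed.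

Lemma negoneK g : (negone * (negone * g) = g)%g.
Proof. by apply: SL2_eqP; rewrite !negoneE !opprK. Qed.

(** The conditions are strictest at the endpoints: x = 0 gives ceil(d/2) = c and x = 1/2 gives
    ceil((d+1)/2) = m. *)
Lemma G_edgeE g : G_edge R val d%:Z g <-> box val c%:Z c%:Z m%:Z g.
Proof.
have Enat (n : nat) : n%:R = n%:Z%:~R :> R by [].
have dE : (d%:R : R) = d./2%:R + d./2%:R + (odd d)%:R.
  by rewrite -!natrD; congr (_%:R); lia.
have cE : (c%:R : R) = d./2%:R + (odd d)%:R by rewrite -natrD; congr (_%:R); lia.
have mE : (m%:R : R) = d./2%:R + 1 by rewrite -[m]addn1 natrD.
have o1 : (odd d)%:R <= 1 :> R by case: (odd d).
have o0 : 0 <= (odd d)%:R :> R by case: (odd d).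
have o2 : (odd d)%:R = 0 :> R \/ (odd d)%:R = 1 :> R by case: (odd d); [right|left].
have ceilc : Num.ceil (d%:~R / 2 : R) = c%:Z.
  apply: ceil_def; rewrite intrB -!Enat cE dE; case: o2 => ->; apply/andP; split; lra.
split=> [h|[g1 g2 g3 g4] x /andP[x0 x1]].
  have /h : 0 <= (0 : R) <= 1 / 2 by apply/andP; split; lra.
  rewrite /Gxr /filtration /= subr0 addr0 ceilc => -[g1 g2 _ g4].
  have /h : 0 <= (1 / 2 : R) <= 1 / 2 by apply/andP; split; lra.
  rewrite /Gxr /filtration /= => -[_ _ g3 _]; split=> //.
  have <- : Num.ceil (d%:~R / 2 + 1 / 2 : R) = m%:Z; last by [].
  by apply: ceil_def; rewrite intrB -!Enat mE dE; case: o2 => ->; apply/andP; split; lra.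
split; rewrite ?ceilc //.
  apply: frac_idealW g2; rewrite ceil_le_int -!Enat cE dE; lra.
apply: frac_idealW g3; rewrite ceil_le_int -!Enat mE dE; lra.
Qed.

Lemma J_subgroup : is_subgroup J.
Proof. by apply: (box_subgroup hk) => //; lia. Qed.

Lemma not_frac_ideal2 (n : int) : 0 < n -> ~ 'P^n (2%:R : k).
Proof. by move=> n0; rewrite (frac_ideal_ge _ val_two) => h; lia. Qed.

(** Since 2 is a unit, 1 and -1 differ modulo P^c. The sign of an element of [Jpm] is therefore well
    defined, and with it the contribution of [theta]. *)
Lemma J_negone g : J g -> ~ J (negone * g)%g.
Proof.
move=> [g1 _ _ _] [+ _ _ _]; rewrite negoneE => h1.
have c0 : 0 < c%:Z :> int by lia.
apply: (not_frac_ideal2 c0).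
have -> : 2%:R = - (g 0 0 - 1) - (- g 0 0 - 1) :> k by ring.
by ideal.
Qed.

Definition Jpm : set G := [set g | J g \/ J (negone * g)%g].

Lemma JpmP g : Jpm g <-> J g \/ exists2 j, J j & g = (negone * j)%g.
Proof.
split=> -[]; [by left| |by left|].
  by right; exists (negone * g)%g; rewrite ?negoneK.
by move=> [j Jj ->]; right; rewrite negoneK.
Qed.

Lemma Jpm_subgroup : is_subgroup Jpm.
Proof.
split; first by left; exact: J_subgroup.1.
have E x : ((negone * x)^-1 = negone * x^-1)%g.
  by apply: SL2_eqP; rewrite !negoneE !SL2_invE !negoneE.
move=> x y /JpmP[Jx|[{}x Jx ->]] /JpmP[Jy|[{}y Jy ->]].
- by left; exact: J_subgroup.2.
- by right; rewrite (mulgA x^-1%g) -negoneC -mulgA negoneK; exact: J_subgroup.2.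
- by right; rewrite E -mulgA negoneK; exact: J_subgroup.2.
- by left; rewrite E -mulgA (mulgA x^-1%g) -negoneC -mulgA negoneK; exact: J_subgroup.2.
Qed.

Lemma J_compact : J `<=` K.
Proof. by apply: (box_max_compact hk) => //; lia. Qed.

Lemma Jpm_compact : Jpm `<=` K.
Proof.
move=> g /JpmP[/J_compact//|[j /J_compact/max_compactE[j1 j2 j3 j4] ->]].
by apply/max_compactE; rewrite !negoneE; split; ideal.
Qed.

Lemma Kn_J : Kn d.+1%:Z `<=` J.
Proof. by apply: box_sub; lia. Qed.

Variables (u : k) (theta : G -> C).
Hypothesis val_u : val u = 0%:E.
Hypothesis theta1 : theta 1%g = 1.

Local Notation X := (antidiag u 0).

Lemma centralizerP a : centralizer_in_K val X a <->
  [/\ K a, a 1 0 = 0 & a 0 0 = a 1 1].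
Proof.
have u0 := val_neq0 hk val_u.
have X2 : ((X 0 0 = 0) * (X 0 1 = u) * (X 1 0 = 0) * (X 1 1 = 0))%type.
  by rewrite !mxE.
split=> [[Ka E]|[Ka a0 a1]].
  have := congr1 (fun M : 'M[k]_2 => M 0 0) E.
  have := congr1 (fun M : 'M[k]_2 => M 0 1) E.
  rewrite !mulmx22 !X2 !mulr0 !mul0r !addr0 !add0r [_ * u]mulrC => /(mulfI u0) e1 /esym/eqP.
  by rewrite mulf_eq0 (negPf u0) /= => /eqP e2.
split=> //; apply/matrixP => i j.
by case: (ord2P i) (ord2P j) => -> [] ->; rewrite !mulmx22 !X2 ?a0 ?a1; ring.
Qed.

Lemma centralizer_sign a : centralizer_in_K val X a ->
  exists2 t, 'P^0 t & a = upper t \/ a = (negone * upper t)%g.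
Proof.
move=> /centralizerP[/max_compactE[_ h2 _ _] a0 a1].
have := SL2_detE a; rewrite a0 a1 mulr0 subr0 => /eqP.
rewrite -expr2 sqrf_eq1 => /orP[/eqP E|/eqP E].
  exists (a 0 1) => //; left.
  by apply: SL2_eqP; rewrite !elementsE a0 a1 E.
exists (- a 0 1); first by ideal.
by right; apply: SL2_eqP; rewrite !negoneE !elementsE a0 a1 E opprK oppr0.
Qed.

Lemma upper_centralizer t : 'P^0 t -> centralizer_in_K val X (upper t).
Proof.
move=> ht; apply/centralizerP; rewrite !elementsE; split=> //.
exact: (upper_compact hk).
Qed.

Lemma negone_centralizer a : centralizer_in_K val X a ->
  centralizer_in_K val X (negone * a)%g.
Proof.
move=> /centralizerP[/max_compactE[h1 h2 h3 h4] a0 a1]; apply/centralizerP.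
rewrite !negoneE a0 a1 oppr0; split=> //.
by apply/max_compactE; rewrite !negoneE; split; ideal.
Qed.

Lemma J_factor g : J g -> exists t j,
  [/\ 'P^0 t, G_edge R val d%:Z j & g = (upper t * j)%g].
Proof.
move=> [g1 g2 g3 g4]; have c0 : 0 < c%:Z :> int by lia.
have E1 := val_cong1 hk c0 g4; have g0 := val_neq0 hk E1.
have iP : 'P^0 (g 1 1)^-1 by rewrite (frac_ideal_ge _ (val_inv hk E1)) oppr0.
exists (g 0 1 / g 1 1), (upper (- (g 0 1 / g 1 1))%R * g)%g; split.
- by ideal.
- apply/G_edgeE/boxP; rewrite !SL2_mulE !elementsE; split.
  + have -> : 1 * g 0 0 + - (g 0 1 / g 1 1) * g 1 0 - 1 =
      (g 0 0 - 1) - g 0 1 * (g 1 1)^-1 * g 1 0 by ring.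
    by ideal.
  + have -> : 1 * g 0 1 + - (g 0 1 / g 1 1) * g 1 1 = 0 by field.
    by ideal.
  + by rewrite mul0r mul1r add0r.
  + by rewrite mul0r mul1r add0r.
- by rewrite mulgA upper_mul subrr; apply: SL2_eqP; rewrite !SL2_mulE !elementsE; split; ring.
Qed.

Lemma prod_set_Jpm : prod_set (centralizer_in_K val X) (G_edge R val d%:Z) = Jpm.
Proof.
have up t j : 'P^0 t -> box val c%:Z c%:Z m%:Z j -> J (upper t * j)%g.
  move=> ht hj; apply: (subgroupM J_subgroup).
    by apply/boxP; rewrite !elementsE subrr; split; ideal.
  by apply: (box_sub _ _ _ hj); lia.
apply/seteqP; split=> g.
  move=> [a /centralizer_sign[t ht [->|->]] [j /G_edgeE hj <-]].
    by left; apply: up.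
  by right; rewrite -mulgA negoneK; apply: up.
move=> [/J_factor|/J_factor] [t [j [ht hj E]]].
  by exists (upper t); [exact: upper_centralizer|exists j].
exists (negone * upper t)%g; first exact/negone_centralizer/upper_centralizer.
by exists j => //; rewrite -mulgA -E negoneK.
Qed.

Lemma inflate_upper t : 'P^0 t -> inflate_central val theta (upper t) = 1
  /\ inflate_central val theta (negone * upper t)%g = theta negone.
Proof.
move=> ht; have uU : unipotent_K val (upper t).
  by split; rewrite ?elementsE //; exact: (upper_compact hk).
have center z : SL2_center z <-> z = 1%g \/ z = negone.
  split=> -[h|h].
  - by left; apply: SL2_eqP; rewrite !elementsE h !mxE.
  - by right; apply: SL2_eqP; rewrite !SL2_ofE h !mxE /= ?mulr1n ?mulr0n ?oppr0.
  - by left; rewrite h.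
  - right; rewrite h; apply/matrixP => i j; rewrite -[negone]mulg1 negoneE.
    by rewrite !mxE.
have not2 : (1 : k) <> -1.
  move=> E; have : 'P^1 (2%:R : k) by rewrite mulr2n {1}E addNr; ideal.
  exact: not_frac_ideal2.
split; apply: prod_char_eq.
- by exists 1%g; [apply/center; left|exists (upper t); rewrite ?mul1g].
- move=> z n /center[->|->] [_ n1 _ _] E; first by rewrite theta1 mulr1.
  by have := congr1 (fun g : G => g 0 0) E; rewrite negoneE elementsE n1 => /not2.
- by exists negone; [apply/center; right|exists (upper t)].
- move=> z n /center[->|->] [_ n1 _ _] E; last by rewrite mulr1.
  have := congr1 (fun g : G => g 0 0) E; rewrite negoneE elementsE mul1g n1.
  by move=> /esym/not2.
Qed.

Definition chi : G -> C :=
  prod_char (centralizer_in_K val X) (inflate_central val theta)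
    (G_edge R val d%:Z) (Psi_X varpi Psi d%:Z X).

Lemma Psi_XE g : Psi_X varpi Psi d%:Z X g = psi_u varpi Psi d u g.
Proof.
rewrite /Psi_X /psi_u; congr (Psi (_ * _)).
rewrite /mxtrace !big_ord_recl big_ord0 addr0 !mxE !big_ord_recl !big_ord0 !mxE /=.
rewrite !mul0r !addr0 !add0r subr0.
by congr (_ * g _ _); apply: val_inj.
Qed.

(** In any factorisation the sign is forced by [J_negone], and an upper unipotent on the left does
    not change the lower left entry; so all factorisations give the same value. *)
Lemma chi_J g : J g -> chi g = psi_u varpi Psi d u g /\
  chi (negone * g)%g = theta negone * psi_u varpi Psi d u g.
Proof.
move=> Jg; have low t j : psi_u varpi Psi d u (upper t * j)%g = psi_u varpi Psi d u j.
  by rewrite /psi_u SL2_mulE !elementsE mul0r mul1r add0r.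
have JK t j : 'P^0 t -> box val c%:Z c%:Z m%:Z j -> J (upper t * j)%g.
  move=> ht hj; apply: (subgroupM J_subgroup).
    by apply/boxP; rewrite !elementsE subrr; split; ideal.
  by apply: (box_sub _ _ _ hj); lia.
split; apply: prod_char_eq.
- by rewrite prod_set_Jpm; left.
- move=> a j /centralizer_sign[t ht [->|->]] /G_edgeE hj E; rewrite Psi_XE.
    by rewrite (inflate_upper ht).1 mul1r E low.
  by move: Jg; rewrite E -mulgA => /J_negone; rewrite negoneK => -[]; apply: JK.
- by rewrite prod_set_Jpm; right; rewrite negoneK.
- move=> a j /centralizer_sign[t ht [->|->]] /G_edgeE hj E; rewrite Psi_XE.
    by have /J_negone := JK _ _ ht hj; rewrite -E negoneK.
  by rewrite (inflate_upper ht).2 -(negoneK g) E -mulgA negoneK low.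
Qed.

Hypothesis theta_negone : theta negone * theta negone = 1.

(** The lower left entry is additive up to an entry in P^m times a diagonal error in P^c, that is,
    up to P^(d+1). *)
Lemma psi_uM g h : J g -> J h ->
  psi_u varpi Psi d u (g * h)%g = psi_u varpi Psi d u g * psi_u varpi Psi d u h.
Proof.
move=> [g1 g2 g3 g4] [h1 h2 h3 h4]; rewrite /psi_u -PsiD; apply: (Psi_cong PsiD Psi_P).
rewrite -mulrDr -mulrBr SL2_mulE -mulrDr -mulrBr.
have Pu : 'P^0 u by rewrite (frac_ideal_ge _ val_u).
have /(scaled_ideal hk val_varpi _ d%:Z) h' :
    'P^(m + c)%:Z (u * (g 1 0 * h 0 0 + g 1 1 * h 1 0 - (g 1 0 + h 1 0))).
  have -> : g 1 0 * h 0 0 + g 1 1 * h 1 0 - (g 1 0 + h 1 0) =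
    g 1 0 * (h 0 0 - 1) + (g 1 1 - 1) * h 1 0 by ring.
  by rewrite mulrDr; ideal.
by apply: frac_idealW h'; lia.
Qed.

Lemma chiM g h : Jpm g -> Jpm h -> chi (g * h)%g = chi g * chi h.
Proof.
move=> /JpmP[Jg|[{}g Jg ->]] /JpmP[Jh|[{}h Jh ->]].
- have Jgh := subgroupM J_subgroup Jg Jh.
  by rewrite (chi_J Jgh).1 (chi_J Jg).1 (chi_J Jh).1 psi_uM.
- have Jgh := subgroupM J_subgroup Jg Jh.
  rewrite mulgA -negoneC -mulgA (chi_J Jgh).2 (chi_J Jg).1 (chi_J Jh).2 psi_uM //.
  by rewrite mulrCA.
- have Jgh := subgroupM J_subgroup Jg Jh.
  by rewrite -mulgA (chi_J Jgh).2 (chi_J Jg).2 (chi_J Jh).1 psi_uM // mulrA.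
- have Jgh := subgroupM J_subgroup Jg Jh.
  rewrite -mulgA (mulgA g) -negoneC -mulgA negoneK.
  rewrite (chi_J Jgh).1 (chi_J Jg).2 (chi_J Jh).2 psi_uM //.
  by rewrite mulrACA theta_negone mul1r.
Qed.

Lemma chi_Kn g : Kn d.+1%:Z g -> chi g = 1.
Proof.
move=> hg; rewrite (chi_J (Kn_J hg)).1 /psi_u Psi_P //; have [_ _ g3 _] := hg.
have Pu : 'P^0 u by rewrite (frac_ideal_ge _ val_u).
have /(scaled_ideal hk val_varpi _ d%:Z) h : 'P^d.+1%:Z (u * g 1 0) by ideal.
by apply: frac_idealW h; lia.
Qed.

(* If the lower left entry of x has valuation < m, conjugation by x moves a
   small upper unipotent out of the kernel of chi; otherwise lower unipotents
   force the diagonal of x to be +-1 modulo P^c. *)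
Lemma intertwining x : K x -> ~ Jpm x ->
  exists j, [/\ Jpm j, Jpm (x * j * x^-1)%g & chi (x * j * x^-1)%g <> chi j].
Proof.
move=> /max_compactE[x1 x2 x3 x4] nJx.
have dE : d%:Z = d./2%:Z + c%:Z :> int by lia.
have cm : c%:Z <= m%:Z :> int by lia.
suff [j [Jj Jxj nchi]] : exists j, [/\ J j, J (x * j * x^-1)%g &
    psi_u varpi Psi d u (x * j * x^-1)%g <> psi_u varpi Psi d u j].
  by exists j; split; [left|left|rewrite (chi_J Jj).1 (chi_J Jxj).1].
have E : x 0 0 * x 1 1 = 1 + x 0 1 * x 1 0 by rewrite -(SL2_detE x) subrK.
have Evd : val (varpi ^ (- d%:Z)) = (- d%:Z)%:E by apply: (val_expz hk).
have [h3|] := pselect ('P^m%:Z (x 1 0)); last first.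
  move=> /(not_frac_ideal hk)[g Eg gm].
  have g0 : 0 <= g by rewrite -(frac_ideal_ge _ Eg).
  have hg : 'P^g (x 1 0) by rewrite (frac_ideal_ge _ Eg).
  (* For t in P^(d-2g), t (x 1 0)^2 runs through P^d, on which the character is nontrivial, whereas
     upper unipotents have character 1. As d - g >= c, the conjugate stays in J. *)
  apply: contrapT => nj; have [] : ~ 'P^(1 - (d%:Z - g - g)) (varpi ^ (- d%:Z) * (u * (x 1 0 * x 1 0))).
    rewrite (frac_ideal_ge _ (val_mul hk Evd (val_mul hk val_u (val_mul hk Eg Eg)))).
    lia.
  apply: (Psi_trivial hk Psi_R) => t ht.
  have ht0 : 'P^0 t by apply: frac_idealW ht; lia.
  apply: contrapT => nt; apply: nj; exists (upper (- t)).
  have E10 : (x * upper (- t) * x^-1)%g 1 0 = t * (x 1 0 * x 1 0).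
    by rewrite !SL2_mulE !SL2_invE !elementsE; ring.
  split.
  - by apply/boxP; rewrite !elementsE subrr; split; ideal.
  - apply/boxP; rewrite E10; split.
    + have -> : (x * upper (- t) * x^-1)%g 0 0 - 1 = t * x 1 0 * x 0 0.
        by rewrite !SL2_mulE !SL2_invE !elementsE; ring: E.
      (* [ideal] uses a single bound per factor, so the weak integrality bounds make way for [hg]
         and [ht]. *)
      by clear x3 ht0; ideal.
    + have -> : (x * upper (- t) * x^-1)%g 0 1 = - (t * (x 0 0 * x 0 0)).
        by rewrite !SL2_mulE !SL2_invE !elementsE; ring.
      by clear ht; ideal.
    + by clear x3 ht0; ideal.
    + have -> : (x * upper (- t) * x^-1)%g 1 1 - 1 = - (t * x 1 0 * x 0 0).
        by rewrite !SL2_mulE !SL2_invE !elementsE; ring: E.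
      by clear x3 ht0; ideal.
  - rewrite /psi_u E10 elementsE !mulr0 (Psi0 hk Psi_P).
    by move=> h; apply: nt; rewrite -h; congr Psi; ring.
clear x3; apply: contrapT => nj; apply: nJx.
have c0 : 0 < c%:Z :> int by lia.
(* Conjugation by x multiplies the lower left entry of [lower y] by (x 1 1)^2. Equal characters for
   all y in P^m put (x 1 1)^2 - 1 in P^(d+1-m) = P^c. *)
have hpm : 'P^c%:Z (x 1 1 * x 1 1 - 1).
  have h : 'P^(1 - m%:Z) (varpi ^ (- d%:Z) * (u * (x 1 1 * x 1 1 - 1))).
    apply: (Psi_trivial hk Psi_R) => y hy.
    apply: contrapT => ny; apply: nj; exists (lower y).
    have E10 : (x * lower y * x^-1)%g 1 0 = y * (x 1 1 * x 1 1).
      by rewrite !SL2_mulE !SL2_invE !elementsE; ring.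
    split.
    - by apply/boxP; rewrite !elementsE subrr; split; ideal.
    - apply/boxP; rewrite E10; split.
      + have -> : (x * lower y * x^-1)%g 0 0 - 1 = y * (x 0 1 * x 1 1).
          by rewrite !SL2_mulE !SL2_invE !elementsE; ring: E.
        by ideal.
      + have -> : (x * lower y * x^-1)%g 0 1 = - (y * (x 0 1 * x 0 1)).
          by rewrite !SL2_mulE !SL2_invE !elementsE; ring.
        by ideal.
      + by ideal.
      + have -> : (x * lower y * x^-1)%g 1 1 - 1 = - (y * (x 0 1 * x 1 1)).
          by rewrite !SL2_mulE !SL2_invE !elementsE; ring: E.
        by ideal.
    - rewrite /psi_u E10 elementsE => h; apply: ny.
      rewrite (_ : _ * y = varpi ^ (- d%:Z) * (u * (y * (x 1 1 * x 1 1)))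
        - varpi ^ (- d%:Z) * (u * y)); last by ring.
      by rewrite PsiD h (PsiN hk PsiD Psi_P).
  move: h; rewrite (frac_ideal_divl hk _ _ Evd) (frac_ideal_divl hk _ _ val_u).
  by apply: frac_idealW; lia.
(* The determinant carries the congruence from one diagonal entry to the other, as x 1 0 lies in
   P^m, inside P^c. *)
have diag e : 'P^0 e -> 'P^c%:Z (x 1 1 - e) -> e * e = 1 -> 'P^c%:Z (x 0 0 - e).
  move=> he h ee; have -> : x 0 0 - e =
      - (x 0 0 * e * (x 1 1 - e)) + e * (x 0 1 * x 1 0).
    have E' : x 0 1 * x 1 0 = x 0 0 * x 1 1 - 1 by rewrite E addrAC subrr add0r.
    by rewrite E'; ring: ee.
  by ideal.
(* Because 2 is a unit, x 1 1 - 1 and x 1 1 + 1 are not both in P; the one that is a unit can be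
   divided out of [hpm]. *)
have [h1|/(not_frac_ideal hk)[n En nc]] := pselect ('P^1 (x 1 1 - 1)).
  have h : 'P^c%:Z (x 1 1 - 1).
    have Ex : val (x 1 1 + 1) = 0%:E.
      apply: (unit_val hk); first by ideal.
      move=> h2; apply: (@not_frac_ideal2 1) => //.
      have -> : 2%:R = (x 1 1 + 1) - (x 1 1 - 1) :> k by ring.
      by ideal.
    move: hpm; have -> : x 1 1 * x 1 1 - 1 = (x 1 1 + 1) * (x 1 1 - 1) by ring.
    by rewrite (frac_ideal_divl hk _ _ Ex) subr0.
  by left; split; [apply: diag; rewrite ?mulr1 //; ideal|..|].
have h : 'P^c%:Z (x 1 1 + 1).
  have Ex : val (x 1 1 - 1) = 0%:E.
    have : 'P^0 (x 1 1 - 1) by ideal.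
    by rewrite En (frac_ideal_ge _ En) => h; congr (_%:E); lia.
  move: hpm; have -> : x 1 1 * x 1 1 - 1 = (x 1 1 - 1) * (x 1 1 + 1) by ring.
  by rewrite (frac_ideal_divl hk _ _ Ex) subr0.
right; apply/boxP; rewrite !negoneE; split; try ideal.
- have -> : - x 0 0 - 1 = - (x 0 0 - (-1)) by ring.
  apply: (frac_idealN hk); apply: diag; rewrite ?opprK ?mulrNN ?mulr1 //.
  by ideal.
- have -> : - x 1 1 - 1 = - (x 1 1 + 1) by ring.
  by ideal.
Qed.

End ShalikaCharacter.

Theorem theorem4p1 (R : realType)
  (k : fieldType) (val : k -> \bar int) (p : nat)
  (hk : is_padic_field val p) (hp : odd p)
  (varpi : k) (hvarpi : val varpi = 1%:E)
  (epsilon : k) (heps_unit : val epsilon = 0%:E)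
  (heps_nonsq : ~ is_square epsilon)
  (heps_choice : ~ is_square (-1 : k) -> epsilon = -1)
  (Psi : k -> R[i])
  (hPsi_add : forall x y, Psi (x + y) = Psi x * Psi y)
  (hPsi_P : forall x, frac_ideal val 1 x -> Psi x = 1)
  (hPsi_R : exists2 x, frac_ideal val 0 x & Psi x <> 1)
  (V : lmodType R[i]) (pi : SL2 k -> {linear V -> V})
  (hpi_rep : is_rep pi) (hpi_smooth : smooth val pi)
  (hpi_irr : irreducible_subrep setT pi setT)
  (r : R) (hr : is_depth val pi setT r)
  (theta : SL2 k -> R[i]) (htheta : central_character pi theta)
  (W : set V) (hW : irreducible_subrep (max_compact val) pi W)
  (s : R) (hs : is_depth_K val pi W s) (hrs : 2 * r < s) :
  exists (d : int) (u : k),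
    [/\ 2 * r < d%:~R, u = 1 \/ u = epsilon &
        rep_iso (max_compact val) pi W
          (@right_regular R[i] (SL2 k))
          (shalika val varpi Psi d (inflate_central val theta)
             (antidiag u 0))].
Proof.
have [[r0 [x [v0 [_ v0n0 v0fix]]]] _] := hr.
have HK := max_compact_subgroup hk.
have s0 : 0 < s by lra.
have [d [d0 sE Wd1 Wd]] := depth_K_integer hk hpi_rep hW hs s0.
have rd : 2 * r < d%:R by rewrite -sE.
have [y y0 fixy] := apartment_fixed_vector hk hpi_rep hpi_smooth hpi_irr hW Wd1
  v0n0 v0fix.
have fixI := iwahori_fixed_vector hk hpi_rep d0 r0 rd y0 Wd1 Wd fixy.
have [WK _ _] := hW.
have [u [w [Pu Ww w0 wpsi]]] :=
  lower_eigenvector hk hvarpi hPsi_add hPsi_P hPsi_R hpi_rep d0 WK fixI.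
have Eu : val u = 0%:E.
  apply: (unit_val hk) => //.
  exact: (eigenvector_unit hk hvarpi hPsi_P d0 Wd Ww w0 wpsi).
have {u Pu Eu w Ww w0 wpsi} [u [w [hu Eu Ww w0 wpsi]]] : exists u w,
    [/\ u = 1 \/ u = epsilon, val u = 0%:E, W w, w <> 0 &
      forall g, box val (d - d./2)%N%:Z 0 d./2.+1%:Z g ->
        pi g w = psi_u varpi Psi d u g *: w].
  have [e [a [he Ee ua]]] : exists e a, [/\ e = 1 \/ e = epsilon, val e = 0%:E & u = e * a ^+ 2].
    have [[a ->]|[a ->]] := square_classes hk hp heps_unit heps_nonsq Eu.
      by exists 1, a; split; [left|exact: val_one hk|rewrite mul1r].
    by exists epsilon, a; split; [right| |].
  have a0 : a != 0.
    by apply/eqP => a0; have := val_neq0 hk Eu; rewrite ua a0 expr0n mulr0 eqxx.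
  have Ea : val a = 0%:E.
    have [n En] := val_finite hk a0; move: Eu.
    rewrite ua expr2 (val_mul hk Ee (val_mul hk En En)) En => -[E].
    by congr (_%:E); lia.
  have i0 : a^-1 != 0 by rewrite invr_eq0.
  have Eia : val a^-1 = 0%:E by rewrite (val_inv hk Ea) oppr0.
  (* Moving the eigenvector by a diagonal matrix multiplies u by the square of its parameter, so u =
     e a^2 calls for the parameter a^-1. *)
  exists e, (pi (diag i0) w); split=> //.
  - case: WK => _ _; apply=> //; apply/max_compactE.
    rewrite !elementsE invrK; split; try exact: (frac_ideal0 hk).
      by rewrite (frac_ideal_ge _ Eia).
    by rewrite (frac_ideal_ge _ Ea).
  - by move=> /(congr1 (pi (diag i0)^-1%g)); rewrite (repK hpi_rep) linear0.
  - move=> g hg; rewrite (eigenvector_diag hk hpi_rep d0 i0 Eia wpsi) //.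
    by congr (psi_u _ _ _ _ _ *: _); rewrite ua; field.
(* [theta] is known only through its action; cancelling the nonzero [w] yields theta(1) = 1 and
   theta(-1)^2 = 1, on which the multiplicativity of [chi] rests. *)
have wI (a b : R[i]) : a *: w = b *: w -> a = b.
  move=> /eqP; rewrite -subr_eq0 -scalerBl scaler_eq0 subr_eq0.
  by move=> /orP[/eqP //|/eqP].
have theta1 : theta 1%g = 1.
  by apply: wI; rewrite -htheta ?(rep1 hpi_rep) ?scale1r //; left.
have piN v : pi (negone k) v = theta (negone k) *: v.
  apply: htheta; right; apply/matrixP => i j.
  by rewrite -[negone k]mulg1 negoneE !mxE.
have thetaN : theta (negone k) * theta (negone k) = 1.
  apply: wI; rewrite -scalerA -!piN -(repM hpi_rep) scale1r.
  by rewrite -[(_ * _)%g]mulg1 -mulgA negoneK (rep1 hpi_rep).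
exists d%:Z, u; split=> //.
rewrite /shalika (prod_set_Jpm R hk d0 Eu) -/(chi val varpi Psi d u theta).
have v2 := val2 hk hp.
have HJ := Jpm_subgroup hk d0.
have sNJ : box val d.+1%:Z d.+1%:Z d.+1%:Z `<=` Jpm val d.
  by move=> g /(Kn_J d0) hg; left.
have [S hS] := Kn_coset_reps hk HK (@Kn_compact _ _ _ hk d.+1) (@subset_refl _ _).
have [S' hS'] := Kn_coset_reps hk HJ sNJ (Jpm_compact hk d0).
(* The averaging subgroup is G_{0,d+}: normal in K, of finite index, trivial on [W] and contained in
   the kernel of [chi]. *)
apply: (irreducible_rep_iso_ind hpi_rep HK HJ (Kn_subgroup hk d.+1) sNJ
  (Jpm_compact hk d0) _ hS hS' _ _ _ hW Wd1 Ww w0).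
- by move=> g h; apply: (Kn_normal hk).
- by move=> g h; apply: (chiM hk v2 hvarpi hPsi_add hPsi_P d0 Eu theta1 thetaN).
- by move=> g; apply: (chi_Kn hk v2 hvarpi hPsi_P d0 Eu theta1).
- by move=> g; apply: (intertwining hk v2 hvarpi hPsi_add hPsi_P hPsi_R d0 Eu theta1).
- move=> b /JpmP[Jb|[j Jj ->]].
    by rewrite wpsi // (chi_J hk v2 varpi Psi d0 Eu theta1 Jb).1.
  rewrite (repM hpi_rep) wpsi // piN scalerA.
  by rewrite (chi_J hk v2 varpi Psi d0 Eu theta1 Jj).2.
Qed.
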